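(* Let $|q|<1$ and let $a,b,z$ be nonzero complex parameters such that no denominator below vanishes. Then: (i) $$\sum_{r=-\infty}^{\infty}\frac{(a;q^2)_rz^rq^{r^2}}{(b;q^2)_r}=\frac{(-zq,-qb/(az);q^2)_{\infty}}{(b,q^2/a;q^2)_{\infty}}\sum_{r=-\infty}^{\infty}\frac{(-azq/b;q^2)_r}{(-zq;q^2)_r}(-b)^rq^{r^2-r}.$$ (ii) If moreover $|b/a|<1$, then $$\sum_{r=-\infty}^{\infty}\frac{(a;q^2)_rz^rq^{r^2}}{(b;q^2)_r}=\frac{(b/a,-qb/(az);q^2)_{\infty}}{(b;q^2)_{\infty}}\sum_{r=-\infty}^{\infty}(-azq/b,a;q^2)_r\left(\frac{b}{a}\right)^r.$$ (iii) $$\sum_{r=-\infty}^{\infty}\frac{(a;q^2)_rz^rq^{r^2}}{(b;q^2)_r}=\frac{(-bq/(az),-qz;q^2)_{\infty}}{(-q^3/(az),-aqz;q^2)_{\infty}}\sum_{r=-\infty}^{\infty}\frac{(1+azq^{4r-1})(a,-azq/b;q^2)_r(baz^2)^rq^{4r^2-4r}}{(1+az/q)(b,-zq;q^2)_r}.$$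
   Context: For $n\ge 0$, $(a;q)_n=\prod_{j=0}^{n-1}(1-aq^j)$, $(a;q)_\infty=\prod_{j\ge0}(1-aq^j)$, and for negative index $(a;q)_{-n}=1/(aq^{-n};q)_n$. Also $(a_1,\dots,a_k;q)_n=(a_1;q)_n\cdots(a_k;q)_n$ (same for $n=\infty$). *)

(* Defs.v *)
From Stdlib Require Import Reals ZArith ClassicalEpsilon.

Declare Scope C_scope.
Delimit Scope C_scope with Cplx.

Record Cplx : Type := Cmk { Re : R ; Im : R }.
Bind Scope C_scope with Cplx.

Definition RtoC (x : R) : Cplx := Cmk x 0.
Coercion RtoC : R >-> Cplx.

Definition Cadd (x y : Cplx) : Cplx := Cmk (Re x + Re y)%R (Im x + Im y)%R.
Definition Copp (x : Cplx) : Cplx := Cmk (- Re x)%R (- Im x)%R.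
Definition Csub (x y : Cplx) : Cplx := Cadd x (Copp y).
Definition Cmul (x y : Cplx) : Cplx :=
  Cmk (Re x * Re y - Im x * Im y)%R (Re x * Im y + Im x * Re y)%R.
(* Cinv 0 = 0 (total inverse) *)
Definition Cinv (x : Cplx) : Cplx :=
  let d := (Re x * Re x + Im x * Im x)%R in Cmk (Re x / d)%R (- Im x / d)%R.
Definition Cdiv (x y : Cplx) : Cplx := Cmul x (Cinv y).
Definition Cnorm (x : Cplx) : R := sqrt (Re x * Re x + Im x * Im x)%R.

Infix "+" := Cadd : C_scope.
Infix "-" := Csub : C_scope.
Notation "- x" := (Copp x) : C_scope.
Infix "*" := Cmul : C_scope.
Infix "/" := Cdiv : C_scope.

Local Open Scope C_scope.

Fixpoint Cpow (x : Cplx) (n : nat) : Cplx :=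
  match n with O => RtoC 1%R | S m => Cpow x m * x end.

Definition CpowZ (x : Cplx) (r : Z) : Cplx :=
  match r with
  | Z0 => RtoC 1%R
  | Zpos p => Cpow x (Pos.to_nat p)
  | Zneg p => Cinv (Cpow x (Pos.to_nat p))
  end.

Fixpoint qpoch (a q : Cplx) (n : nat) : Cplx :=
  match n with
  | O => RtoC 1%R
  | S m => qpoch a q m * (RtoC 1%R - a * Cpow q m)
  end.

Definition qpochZ (a q : Cplx) (r : Z) : Cplx :=
  match r with
  | Z0 => RtoC 1%R
  | Zpos p => qpoch a q (Pos.to_nat p)
  | Zneg p => Cinv (qpoch (a * CpowZ q (Zneg p)) q (Pos.to_nat p))
  end.

Definition C_cv (u : nat -> Cplx) (l : Cplx) : Prop :=
  forall eps : R, (eps > 0)%R ->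
    exists N : nat, forall n : nat, (N <= n)%nat -> (Cnorm (u n - l) < eps)%R.

Definition Clim (u : nat -> Cplx) : Cplx :=
  epsilon (inhabits (RtoC 0%R)) (fun l => C_cv u l).

Definition qpinf (a q : Cplx) : Cplx := Clim (qpoch a q).

Fixpoint Csum (f : nat -> Cplx) (n : nat) : Cplx :=
  match n with O => RtoC 0%R | S m => Csum f m + f m end.

Definition bisum (f : Z -> Cplx) : Cplx :=
  Clim (Csum (fun k => f (Z.of_nat k))) + Clim (Csum (fun k => f (- Z.of_nat (S k)))%Z).

(* (x;q)_r is well defined (and nonzero) for all negative r:
   this is the non-vanishing of the denominators hidden in negative-index
   Pochhammer symbols appearing in numerators. *)
Definition poch_neg_ok (x q : Cplx) : Prop :=
  forall r : Z, (r < 0)%Z -> qpochZ x q r <> RtoC 0%R.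

(* (x;q)_r is nonzero (and well defined) for every integer r:
   needed for Pochhammer symbols appearing in denominators. *)
Definition poch_all_nz (x q : Cplx) : Prop :=
  forall r : Z, qpochZ x q r <> RtoC 0%R.

(* Main.v *)
(** Write p = q^2, y = -azq, c = 1/a, d = b/y and P(u) = (u; p)_oo. Clearing the
    infinite products, each bilateral series becomes a multiple of one of
      F(c,d) = sum_r P(dy p^r) P(c p^(1-r)) y^r p^(r(r-1)),
      G(c,d) = P(ycd) sum_r P(c p^(1-r)) P(d p^(1-r)) y^r p^(r(r-1)),
      R(c,d) = sum_r (1 - y p^(2r-1)) P(dy p^r) P(cy p^r) P(c p^(1-r)) P(d p^(1-r))
               y^(3r) p^(3r^2-4r),
    and the three claims read F(c,d) = F(d,c), F = G, -(y/p) P(y) P(p/y) F = R.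
    By telescoping, each X among these has a common divided difference
      U(c,d) = (X(c,d) - X(cp,d)) / c = (X(c,d) - X(c,dp)) / d
    with U(c,d) - U(c,dp) = y p d X(cp,dp). This system expresses (X,U)(c,d) through
    (X,U)(cp,dp) by a matrix I + O(|c| + |d|), so a solution is determined by its limit
    along (c p^n, d p^n). Tannery's theorem gives these limits; they do not depend on c and
    d, and are visibly the same for F, its transpose and G. For R they agree with those of
    the multiple of F because at c = 1, d = p/y both series terminate and can be evaluated. *)

(* Convergence shapes the proof. With sigma = |q|, [P(u p^(-n))] can grow like sigma^(-n^2) times a
   geometric factor, while [y^r p^(r(r-1))] decays like sigma^(2 r^2) and the weight of R like
   sigma^(6 r^2). In each direction one product grows in F and two in R, so Gaussian decay survives
   for all c, d. In G both products grow as r tends to +oo, the Gaussian parts cancel, and a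
   geometric ratio ycd = b/a is left: this is where |b/a| < 1 enters. The relation for U shifts both
   arguments at once, which is why the system is followed along the diagonal. The limit of F there
   is a theta series that is never evaluated. The limit of R is another series, and its
   proportionality to that theta series is the quintuple product identity. It is not assumed: the
   system is run outward from c = 1, d = p/y, where ycd = p and each step is invertible because its
   determinants have the form 1 - p^n with n >= 2. The factor -(y/p) P(y) P(p/y) is the ratio of the
   two terminating sums at that point. *)
From Stdlib Require Import Reals ZArith Lra Lia Field ClassicalEpsilon.
From Coquelicot Require Import Rbar Hierarchy Lim_seq Series.
Require Import Defs.
Local Open Scope C_scope.

Local Notation "0" := (RtoC 0%R) : C_scope.
Local Notation "1" := (RtoC 1%R) : C_scope.

(** * Complex arithmetic *)

Lemma Cplx_ext (x y : Cplx) : Re x = Re y -> Im x = Im y -> x = y.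
Proof. destruct x, y; simpl; intros; subst; reflexivity. Qed.

Lemma Cplx_neq0 (x : Cplx) : x <> 0 -> (0 < Re x * Re x + Im x * Im x)%R.
Proof.
intros H. destruct (Req_dec (Re x) 0) as [e|e]; [|nra].
destruct (Req_dec (Im x) 0) as [e'|e']; [|nra].
exfalso; apply H, Cplx_ext; simpl; auto.
Qed.

Lemma Cplx_field_theory :
  field_theory 0 1 Cadd Cmul Csub Copp Cdiv Cinv (@eq Cplx).
Proof.
constructor.
- constructor; intros; apply Cplx_ext; simpl; ring.
- intros H; injection H; lra.
- reflexivity.
- intros x H; apply Cplx_neq0 in H; apply Cplx_ext; simpl; field; lra.
Qed.

Add Field Cplx_field : Cplx_field_theory.

Lemma Cone_neq0 : 1 <> 0.
Proof. intros H; injection H; lra. Qed.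

Lemma Cmul_eq0 (x y : Cplx) : x * y = 0 -> x = 0 \/ y = 0.
Proof.
intros H. destruct (excluded_middle_informative (x = 0)) as [e|e]; [now left|right].
replace y with (Cinv x * (x * y)) by (field; auto). rewrite H; ring.
Qed.

Lemma Cmul_neq0 (x y : Cplx) : x <> 0 -> y <> 0 -> x * y <> 0.
Proof. intros hx hy H; destruct (Cmul_eq0 _ _ H); auto. Qed.

Lemma Cmul_cancel_l (x y z : Cplx) : x <> 0 -> x * y = x * z -> y = z.
Proof.
intros hx H. replace y with (x * y / x) by (field; auto). rewrite H; field; auto.
Qed.

Lemma Cinv_neq0 (x : Cplx) : x <> 0 -> Cinv x <> 0.
Proof.
intros hx H. apply Cone_neq0. replace 1 with (x * Cinv x) by (field; auto).
rewrite H; ring.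
Qed.

Lemma Cinv0 : Cinv 0 = 0.
Proof. apply Cplx_ext; simpl; unfold Rdiv; ring. Qed.

Lemma Csub_eq0 (x y : Cplx) : x - y = 0 -> x = y.
Proof. intros H. replace x with (x - y + y) by ring. rewrite H; ring. Qed.

Lemma Cnorm_ge0 (x : Cplx) : (0 <= Cnorm x)%R.
Proof. apply sqrt_pos. Qed.

Lemma Cnorm_sqr (x : Cplx) : (Cnorm x * Cnorm x = Re x * Re x + Im x * Im x)%R.
Proof. apply sqrt_sqrt; nra. Qed.

Lemma Cnorm_unique (x : Cplx) (r : R) :
  (0 <= r)%R -> (r * r = Re x * Re x + Im x * Im x)%R -> Cnorm x = r.
Proof. intros hr H. unfold Cnorm. rewrite <- H. now apply sqrt_square. Qed.

Lemma Cnorm_mul (x y : Cplx) : Cnorm (x * y) = (Cnorm x * Cnorm y)%R.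
Proof.
apply Cnorm_unique.
- apply Rmult_le_pos; apply Cnorm_ge0.
- replace (Cnorm x * Cnorm y * (Cnorm x * Cnorm y))%R
    with ((Cnorm x * Cnorm x) * (Cnorm y * Cnorm y))%R by ring.
  rewrite !Cnorm_sqr; simpl; ring.
Qed.

Lemma Cnorm0 : Cnorm 0 = 0%R.
Proof. apply Cnorm_unique; simpl; lra. Qed.

Lemma Cnorm1 : Cnorm 1 = 1%R.
Proof. apply Cnorm_unique; simpl; lra. Qed.

Lemma Cnorm_opp (x : Cplx) : Cnorm (- x) = Cnorm x.
Proof. apply Cnorm_unique; [apply Cnorm_ge0|rewrite Cnorm_sqr; simpl; ring]. Qed.

Lemma Cnorm_gt0 (x : Cplx) : x <> 0 -> (0 < Cnorm x)%R.
Proof. intros H. apply sqrt_lt_R0. now apply Cplx_neq0. Qed.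

Lemma Cnorm_eq0 (x : Cplx) : Cnorm x = 0%R -> x = 0.
Proof.
intros H. destruct (excluded_middle_informative (x = 0)) as [e|e]; auto.
apply Cnorm_gt0 in e; lra.
Qed.

Lemma Cnorm_inv (x : Cplx) : x <> 0 -> Cnorm (Cinv x) = (/ Cnorm x)%R.
Proof.
intros H. apply Rmult_eq_reg_l with (Cnorm x).
- rewrite <- Cnorm_mul. replace (x * Cinv x) with 1 by (field; auto).
  rewrite Cnorm1. field. apply Cnorm_gt0 in H; lra.
- apply Cnorm_gt0 in H; lra.
Qed.

Lemma Cnorm_add (x y : Cplx) : (Cnorm (x + y) <= Cnorm x + Cnorm y)%R.
Proof.
apply Rsqr_incr_0_var; unfold Rsqr.
- replace ((Cnorm x + Cnorm y) * (Cnorm x + Cnorm y))%R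
    with (Cnorm x * Cnorm x + Cnorm y * Cnorm y + 2 * (Cnorm x * Cnorm y))%R by ring.
  rewrite !Cnorm_sqr.
  enough (Re x * Re y + Im x * Im y <= Cnorm (x * y))%R
    by (rewrite <- (Cnorm_mul x y); unfold Cadd; cbn [Re Im]; lra).
  apply Rle_trans with (Rabs (Re x * Re y + Im x * Im y)); [apply Rle_abs|].
  rewrite <- sqrt_Rsqr_abs. apply sqrt_le_1_alt. unfold Rsqr; simpl.
  generalize (Rle_0_sqr (Re x * Im y - Im x * Re y)); unfold Rsqr; lra.
- generalize (Cnorm_ge0 x) (Cnorm_ge0 y); lra.
Qed.

Lemma Cnorm_sub (x y : Cplx) : (Cnorm (x - y) <= Cnorm x + Cnorm y)%R.
Proof. unfold Csub. rewrite <- (Cnorm_opp y). apply Cnorm_add. Qed.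

Lemma Cnorm_sub_sym (x y : Cplx) : Cnorm (x - y) = Cnorm (y - x).
Proof. rewrite <- Cnorm_opp. f_equal. ring. Qed.

Lemma Re_le_Cnorm (x : Cplx) : (Rabs (Re x) <= Cnorm x)%R.
Proof. rewrite <- sqrt_Rsqr_abs. apply sqrt_le_1_alt. unfold Rsqr; nra. Qed.

Lemma Im_le_Cnorm (x : Cplx) : (Rabs (Im x) <= Cnorm x)%R.
Proof. rewrite <- sqrt_Rsqr_abs. apply sqrt_le_1_alt. unfold Rsqr; nra. Qed.

Lemma Cnorm_le_Re_Im (x : Cplx) : (Cnorm x <= Rabs (Re x) + Rabs (Im x))%R.
Proof.
apply Rsqr_incr_0_var; unfold Rsqr.
- rewrite Cnorm_sqr. rewrite <- (Rabs_pos_eq (Re x * Re x)), <- (Rabs_pos_eq (Im x * Im x)) by nra.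
  rewrite !Rabs_mult. generalize (Rabs_pos (Re x)) (Rabs_pos (Im x)); nra.
- generalize (Rabs_pos (Re x)) (Rabs_pos (Im x)); lra.
Qed.

Lemma Cnorm_pow (x : Cplx) (n : nat) : Cnorm (Cpow x n) = (Cnorm x ^ n)%R.
Proof. induction n; simpl; [apply Cnorm1|rewrite Cnorm_mul, IHn; ring]. Qed.

Lemma Cpow_neq0 (x : Cplx) (n : nat) : x <> 0 -> Cpow x n <> 0.
Proof.
intros hx; induction n; simpl; [apply Cone_neq0|now apply Cmul_neq0].
Qed.

Lemma Cpow_add (x : Cplx) (m n : nat) : Cpow x (m + n) = Cpow x m * Cpow x n.
Proof. induction n; rewrite ?Nat.add_0_r, ?Nat.add_succ_r; simpl; [|rewrite IHn]; ring. Qed.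

Lemma CpowZ_nat (x : Cplx) (n : nat) : CpowZ x (Z.of_nat n) = Cpow x n.
Proof. destruct n; simpl; [reflexivity|now rewrite SuccNat2Pos.id_succ]. Qed.

Lemma CpowZ_neg (x : Cplx) (n : nat) : CpowZ x (- Z.of_nat n) = Cinv (Cpow x n).
Proof.
destruct n; simpl; [|now rewrite SuccNat2Pos.id_succ].
apply Cplx_ext; simpl; field.
Qed.

Lemma CpowZ_neq0 (x : Cplx) (r : Z) : x <> 0 -> CpowZ x r <> 0.
Proof.
intros hx; destruct r; simpl; [apply Cone_neq0|now apply Cpow_neq0|].
now apply Cinv_neq0, Cpow_neq0.
Qed.

Lemma Z_nat_cases (r : Z) : exists n : nat, r = Z.of_nat n \/ r = (- Z.of_nat (S n))%Z.
Proof.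
destruct (Z_le_gt_dec 0 r).
- exists (Z.to_nat r); left; lia.
- exists (Z.to_nat (- r - 1)); right; lia.
Qed.

Lemma CpowZ_succ (x : Cplx) (r : Z) : x <> 0 -> CpowZ x (r + 1) = CpowZ x r * x.
Proof.
intros hx. destruct (Z_nat_cases r) as [n [->| ->]].
- replace (Z.of_nat n + 1)%Z with (Z.of_nat (S n)) by lia.
  now rewrite !CpowZ_nat.
- replace (- Z.of_nat (S n) + 1)%Z with (- Z.of_nat n)%Z by lia.
  rewrite !CpowZ_neg; simpl. field. split; [auto|now apply Cpow_neq0].
Qed.

Lemma Z_bi_ind (P : Z -> Prop) :
  P 0%Z -> (forall r, P r -> P (r + 1)%Z) -> (forall r, P (r + 1)%Z -> P r) ->
  forall r, P r.
Proof.
intros h0 hs hp r. apply Z.bi_induction; auto.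
- intros ? ? ->; reflexivity.
- intros n; split; [apply hs|apply hp].
Qed.

Lemma CpowZ_add (x : Cplx) (r s : Z) : x <> 0 -> CpowZ x (r + s) = CpowZ x r * CpowZ x s.
Proof.
intros hx. revert s. apply Z_bi_ind.
- rewrite Z.add_0_r; simpl; ring.
- intros s H. rewrite Z.add_assoc, !CpowZ_succ, H by auto; ring.
- intros s H. rewrite Z.add_assoc, !CpowZ_succ in H by auto.
  apply Cmul_cancel_l with x; auto.
  transitivity (CpowZ x (r + s) * x); [ring|rewrite H; ring].
Qed.

Lemma CpowZ_mul (x : Cplx) (r s : Z) : x <> 0 -> CpowZ x (r * s) = CpowZ (CpowZ x r) s.
Proof.
intros hx. assert (h := CpowZ_neq0 x r hx). revert s. apply Z_bi_ind.
- now rewrite Z.mul_0_r.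
- intros s H. rewrite Z.mul_add_distr_l, Z.mul_1_r, CpowZ_add, CpowZ_succ, H; auto.
- intros s H. rewrite Z.mul_add_distr_l, Z.mul_1_r, CpowZ_add, CpowZ_succ in H by auto.
  apply Cmul_cancel_l with (CpowZ x r); auto.
  transitivity (CpowZ x (r * s) * CpowZ x r); [ring|rewrite H; ring].
Qed.

Lemma CpowZ_1 (x : Cplx) : CpowZ x 1 = x.
Proof. simpl; ring. Qed.

Lemma CpowZ_opp (x : Cplx) (r : Z) : x <> 0 -> CpowZ x (- r) = Cinv (CpowZ x r).
Proof.
intros hx. apply Cmul_cancel_l with (CpowZ x r); [now apply CpowZ_neq0|].
rewrite <- CpowZ_add, Z.add_opp_diag_r by auto. simpl.
field. now apply CpowZ_neq0.
Qed.

Lemma CpowZ_mul_base (x y : Cplx) (r : Z) :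
  x <> 0 -> y <> 0 -> CpowZ (x * y) r = CpowZ x r * CpowZ y r.
Proof.
intros hx hy. assert (hxy := Cmul_neq0 _ _ hx hy). revert r. apply Z_bi_ind.
- simpl; ring.
- intros r H. rewrite !CpowZ_succ, H by auto; ring.
- intros r H. rewrite !CpowZ_succ in H by auto.
  apply Cmul_cancel_l with (x * y); auto.
  transitivity (CpowZ (x * y) r * (x * y)); [ring|rewrite H; ring].
Qed.

Lemma Cnorm_powZ (x : Cplx) (r : Z) : x <> 0 -> Cnorm (CpowZ x r) = powerRZ (Cnorm x) r.
Proof.
intros hx; destruct r; simpl; [apply Cnorm1|apply Cnorm_pow|].
rewrite Cnorm_inv, Cnorm_pow; auto. now apply Cpow_neq0.
Qed.

(** * Limits and bilateral series *)

Lemma C_cv_iff (u : nat -> Cplx) (l : Cplx) :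
  C_cv u l <-> is_lim_seq (fun n => Cnorm (u n - l)) 0%R.
Proof.
rewrite <- is_lim_seq_spec; split.
- intros H eps. destruct (H eps (cond_pos eps)) as [N HN].
  exists N; intros n hn. rewrite Rminus_0_r, Rabs_pos_eq by apply Cnorm_ge0. auto.
- intros H eps he. destruct (H (mkposreal eps he)) as [N HN].
  exists N; intros n hn. specialize (HN n hn).
  now rewrite Rminus_0_r, Rabs_pos_eq in HN by apply Cnorm_ge0.
Qed.

Lemma C_cv_squeeze (u : nat -> Cplx) (l : Cplx) (g : nat -> R) :
  (forall n, (Cnorm (u n - l) <= g n)%R) -> is_lim_seq g 0%R -> C_cv u l.
Proof.
intros H hg. apply C_cv_iff.
apply is_lim_seq_le_le with (fun _ => 0%R) g; auto using is_lim_seq_const.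
split; auto using Cnorm_ge0.
Qed.

Lemma C_cv_ext (u v : nat -> Cplx) (l : Cplx) :
  (forall n, u n = v n) -> C_cv u l -> C_cv v l.
Proof. intros H hu eps he. destruct (hu eps he) as [N HN]. exists N; intros; rewrite <- H; auto. Qed.

Lemma C_cv_const (l : Cplx) : C_cv (fun _ => l) l.
Proof.
intros eps he; exists O; intros. replace (l - l) with 0 by ring. now rewrite Cnorm0.
Qed.

Lemma C_cv_add (u v : nat -> Cplx) (l m : Cplx) :
  C_cv u l -> C_cv v m -> C_cv (fun n => u n + v n) (l + m).
Proof.
rewrite !(C_cv_iff u), !(C_cv_iff v). intros hu hv.
apply C_cv_squeeze with (fun n => Cnorm (u n - l) + Cnorm (v n - m))%R.
- intros n. replace (u n + v n - (l + m)) with ((u n - l) + (v n - m)) by ring.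
  apply Cnorm_add.
- replace 0%R with (0 + 0)%R by ring. now apply is_lim_seq_plus'.
Qed.

Lemma C_cv_mul (u v : nat -> Cplx) (l m : Cplx) :
  C_cv u l -> C_cv v m -> C_cv (fun n => u n * v n) (l * m).
Proof.
rewrite !(C_cv_iff u), !(C_cv_iff v). intros hu hv.
apply C_cv_squeeze with (fun n => Cnorm (u n - l) * Cnorm (v n - m)
  + (Cnorm l * Cnorm (v n - m) + Cnorm m * Cnorm (u n - l)))%R.
- intros n. rewrite <- !Cnorm_mul.
  replace (u n * v n - l * m)
    with ((u n - l) * (v n - m) + (l * (v n - m) + m * (u n - l))) by ring.
  eapply Rle_trans; [apply Cnorm_add|]. apply Rplus_le_compat_l, Cnorm_add.
- replace 0%R with (0 * 0 + (Cnorm l * 0 + Cnorm m * 0))%R by ring.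
  apply is_lim_seq_plus'; [now apply is_lim_seq_mult'|].
  apply is_lim_seq_plus'; apply is_lim_seq_mult'; auto using is_lim_seq_const.
Qed.

Lemma C_cv_opp (u : nat -> Cplx) (l : Cplx) : C_cv u l -> C_cv (fun n => - u n) (- l).
Proof.
intros H. apply C_cv_ext with (fun n => - (1) * u n); [intros; ring|].
replace (- l) with (- (1) * l) by ring. apply C_cv_mul; auto using C_cv_const.
Qed.

Lemma C_cv_sub (u v : nat -> Cplx) (l m : Cplx) :
  C_cv u l -> C_cv v m -> C_cv (fun n => u n - v n) (l - m).
Proof. intros hu hv. apply C_cv_add; auto using C_cv_opp. Qed.

Lemma C_cv_norm (u : nat -> Cplx) (l : Cplx) :
  C_cv u l -> is_lim_seq (fun n => Cnorm (u n)) (Cnorm l).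
Proof.
rewrite C_cv_iff. intros H.
apply is_lim_seq_le_le with (fun n => Cnorm l - Cnorm (u n - l))%R (fun n => Cnorm l + Cnorm (u n - l))%R.
- intros n; split.
  + rewrite Cnorm_sub_sym. generalize (Cnorm_add (l - u n) (u n)).
    replace (l - u n + u n) with l by ring. lra.
  + generalize (Cnorm_add (u n - l) l). replace (u n - l + l) with (u n) by ring. lra.
- assert (h := is_lim_seq_minus' _ _ _ _ (is_lim_seq_const (Cnorm l)) H).
  now rewrite Rminus_0_r in h.
- assert (h := is_lim_seq_plus' _ _ _ _ (is_lim_seq_const (Cnorm l)) H).
  now rewrite Rplus_0_r in h.
Qed.

Lemma C_cv_le (u : nat -> Cplx) (l : Cplx) (M : R) :
  C_cv u l -> (forall n, (Cnorm (u n) <= M)%R) -> (Cnorm l <= M)%R.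
Proof.
intros H hM. apply C_cv_norm in H.
exact (is_lim_seq_le _ (fun _ => M) _ _ hM H (is_lim_seq_const M)).
Qed.

Lemma C_cv_unique (u : nat -> Cplx) (l m : Cplx) : C_cv u l -> C_cv u m -> l = m.
Proof.
intros hl hm. apply Csub_eq0, Cnorm_eq0, Rle_antisym; [|apply Cnorm_ge0].
apply C_cv_le with (fun n => u n - u n); [now apply C_cv_sub|].
intros n. replace (u n - u n) with 0 by ring. rewrite Cnorm0; apply Rle_refl.
Qed.

Lemma Clim_eq (u : nat -> Cplx) (l : Cplx) : C_cv u l -> Clim u = l.
Proof.
intros H. apply C_cv_unique with u; auto.
unfold Clim. apply epsilon_spec. now exists l.
Qed.

Lemma C_cv_succ (u : nat -> Cplx) (l : Cplx) : C_cv (fun n => u (S n)) l <-> C_cv u l.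
Proof. rewrite !C_cv_iff. symmetry. apply is_lim_seq_incr_1. Qed.

Lemma is_lim_seq_geom0 (k M : R) :
  (0 <= k < 1)%R -> is_lim_seq (fun n => M * k ^ n)%R 0%R.
Proof.
intros hk. replace 0%R with (M * 0)%R by ring.
apply is_lim_seq_mult'; [apply is_lim_seq_const|apply is_lim_seq_geom].
now rewrite Rabs_pos_eq.
Qed.

(** * Partial sums under geometric domination *)

Lemma Csum_ext (f g : nat -> Cplx) (n : nat) : (forall k, f k = g k) -> Csum f n = Csum g n.
Proof. intros H; induction n; simpl; [|rewrite IHn, H]; reflexivity. Qed.

Lemma Csum_add (f g : nat -> Cplx) (n : nat) :
  Csum (fun k => f k + g k) n = Csum f n + Csum g n.
Proof. induction n; simpl; [|rewrite IHn]; ring. Qed.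

Lemma Csum_scal (c : Cplx) (f : nat -> Cplx) (n : nat) :
  Csum (fun k => c * f k) n = c * Csum f n.
Proof. induction n; simpl; [|rewrite IHn]; ring. Qed.

Lemma Csum_shift (f : nat -> Cplx) (n : nat) :
  Csum f (S n) = f O + Csum (fun k => f (S k)) n.
Proof. induction n; [simpl; ring|]. change (Csum f (S (S n))) with (Csum f (S n) + f (S n)). rewrite IHn; simpl; ring. Qed.

Lemma Csum_tail_le (f : nat -> Cplx) (M k : R) (N n : nat) :
  (0 <= k < 1)%R -> (forall n, (Cnorm (f n) <= M * k ^ n)%R) ->
  (Cnorm (Csum f (N + n) - Csum f N) <= M * k ^ N * (1 - k ^ n) / (1 - k))%R.
Proof.
intros hk hf; induction n.
- rewrite Nat.add_0_r. replace (Csum f N - Csum f N) with 0 by ring.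
  rewrite Cnorm0; simpl. apply Req_le; field; lra.
- rewrite Nat.add_succ_r; simpl.
  replace (Csum f (N + n) + f (N + n)%nat - Csum f N)
    with ((Csum f (N + n) - Csum f N) + f (N + n)%nat) by ring.
  eapply Rle_trans; [apply Cnorm_add|].
  eapply Rle_trans; [apply Rplus_le_compat; [apply IHn|apply hf]|].
  rewrite pow_add. apply Req_le; field; lra.
Qed.

Lemma Csum_cv (f : nat -> Cplx) (M k : R) :
  (0 <= k < 1)%R -> (forall n, (Cnorm (f n) <= M * k ^ n)%R) ->
  exists l, C_cv (Csum f) l.
Proof.
intros hk hf.
assert (hg : ex_series (fun n => M * k ^ n)%R).
{ destruct (ex_series_geom k) as [x hx]; [now rewrite Rabs_pos_eq|].
  exists (M * x)%R. exact (is_series_scal_l M _ _ hx). }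
assert (hr : ex_series (fun n => Re (f n))).
{ apply (@ex_series_le R_AbsRing R_CompleteNormedModule _ (fun n => M * k ^ n)%R); auto. intros n.
  exact (Rle_trans _ _ _ (Re_le_Cnorm _) (hf n)). }
assert (hi : ex_series (fun n => Im (f n))).
{ apply (@ex_series_le R_AbsRing R_CompleteNormedModule _ (fun n => M * k ^ n)%R); auto. intros n.
  exact (Rle_trans _ _ _ (Im_le_Cnorm _) (hf n)). }
destruct hr as [x hx], hi as [y hy]. exists (Cmk x y).
(* [sum_n] includes its upper index and [Csum] stops before it, hence the shift by one. *)
assert (hS : forall n, Csum f (S n)
  = Cmk (sum_n (fun n => Re (f n)) n) (sum_n (fun n => Im (f n)) n)).
{ induction n.
  - rewrite !sum_O. apply Cplx_ext; simpl; ring.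
  - rewrite !sum_Sn. change (Csum f (S (S n))) with (Csum f (S n) + f (S n)).
    rewrite IHn. apply Cplx_ext; reflexivity. }
apply C_cv_succ, C_cv_squeeze with
  (fun n => Rabs (sum_n (fun n => Re (f n)) n - x) + Rabs (sum_n (fun n => Im (f n)) n - y))%R.
- intros n. rewrite hS. apply Cnorm_le_Re_Im.
- replace 0%R with (Rabs (x - x) + Rabs (y - y))%R
    by (rewrite !Rminus_diag, Rabs_R0; ring).
  apply is_lim_seq_plus';
    apply (is_lim_seq_abs _ (Finite _)), is_lim_seq_minus';
    first [apply is_lim_seq_const|exact hx|exact hy].
Qed.

Lemma Csum_lim_tail (f : nat -> Cplx) (l : Cplx) (M k : R) (N : nat) :
  (0 <= k < 1)%R -> (forall n, (Cnorm (f n) <= M * k ^ n)%R) -> C_cv (Csum f) l ->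
  (Cnorm (l - Csum f N) <= M / (1 - k) * k ^ N)%R.
Proof.
intros hk hf hl.
assert (hM : (0 <= M)%R).
{ specialize (hf O); simpl in hf. generalize (Cnorm_ge0 (f O)); lra. }
apply C_cv_le with (fun n => Csum f (N + n) - Csum f N).
- apply C_cv_sub; [|apply C_cv_const]. intros eps he.
  destruct (hl eps he) as [n0 H]. exists n0; intros n hn; apply H; lia.
- intros n. eapply Rle_trans; [now apply Csum_tail_le with (1 := hk)|].
  assert (h1 := pow_le k n (proj1 hk)). assert (h2 := pow_le k N (proj1 hk)).
  unfold Rdiv. replace (M * / (1 - k) * k ^ N)%R with (M * k ^ N * 1 * / (1 - k))%R by ring.
  apply Rmult_le_compat_r; [apply Rlt_le, Rinv_0_lt_compat; lra|].
  apply Rmult_le_compat_l; [now apply Rmult_le_pos|lra].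
Qed.

Lemma Csum_lim (f : nat -> nat -> Cplx) (g : nat -> Cplx) (N : nat) :
  (forall n, C_cv (fun k => f k n) (g n)) -> C_cv (fun k => Csum (f k) N) (Csum g N).
Proof.
intros H; induction N; simpl; [apply C_cv_const|now apply C_cv_add].
Qed.

(** Cut at an [N] where the common majorant has tail below eps/3: both tails are then small
    uniformly in [j], and only a finite head has to converge. *)
Lemma Csum_tannery (f : nat -> nat -> Cplx) (g : nat -> Cplx) (L : nat -> Cplx) (l : Cplx) (M k : R) :
  (0 <= k < 1)%R -> (forall j n, (Cnorm (f j n) <= M * k ^ n)%R) ->
  (forall n, C_cv (fun j => f j n) (g n)) ->
  (forall j, C_cv (Csum (f j)) (L j)) -> C_cv (Csum g) l -> C_cv L l.
Proof.
intros hk hf hg hL hl eps he.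
assert (hgb : forall n, (Cnorm (g n) <= M * k ^ n)%R).
{ intros n. apply C_cv_le with (1 := hg n). intros j; apply hf. }
assert (h0 := is_lim_seq_geom0 k (M / (1 - k)) hk).
apply is_lim_seq_spec in h0.
destruct (h0 (mkposreal (eps / 3) ltac:(lra))) as [N hN]. specialize (hN N (Nat.le_refl N)).
simpl in hN. rewrite Rminus_0_r in hN. apply Rabs_def2 in hN. destruct hN as [hN _].
destruct (Csum_lim f g N hg (eps / 3)%R ltac:(lra)) as [N' hN'].
exists N'; intros j hj. specialize (hN' j hj).
assert (h1 := Csum_lim_tail _ _ M k N hk (hf j) (hL j)).
assert (h2 := Csum_lim_tail _ _ M k N hk hgb hl).
rewrite Cnorm_sub_sym in h2.
replace (L j - l) with ((L j - Csum (f j) N) + ((Csum (f j) N - Csum g N) + (Csum g N - l))) by ring.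
eapply Rle_lt_trans; [apply Cnorm_add|].
assert (h3 := Cnorm_add (Csum (f j) N - Csum g N) (Csum g N - l)). lra.
Qed.

(** [Clim] is a choice and says nothing about a divergent sequence, so sums are handled through this
    relation and returned to [bisum] by [bisum_eq]. *)
Definition bicv (f : Z -> Cplx) (l : Cplx) : Prop :=
  exists l1 l2, C_cv (Csum (fun k => f (Z.of_nat k))) l1
    /\ C_cv (Csum (fun k => f (- Z.of_nat (S k))%Z)) l2 /\ l = l1 + l2.

Lemma bisum_eq (f : Z -> Cplx) (l : Cplx) : bicv f l -> bisum f = l.
Proof.
intros (l1 & l2 & h1 & h2 & ->). unfold bisum.
now rewrite (Clim_eq _ _ h1), (Clim_eq _ _ h2).
Qed.

Lemma bicv_ext (f g : Z -> Cplx) (l : Cplx) : (forall r, f r = g r) -> bicv f l -> bicv g l.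
Proof.
intros H (l1 & l2 & h1 & h2 & e). exists l1, l2; repeat split; auto.
- eapply C_cv_ext; [|exact h1]. intros n; now apply Csum_ext.
- eapply C_cv_ext; [|exact h2]. intros n; now apply Csum_ext.
Qed.

Lemma bicv_add (f g : Z -> Cplx) (l m : Cplx) :
  bicv f l -> bicv g m -> bicv (fun r => f r + g r) (l + m).
Proof.
intros (l1 & l2 & h1 & h2 & ->) (m1 & m2 & h3 & h4 & ->).
exists (l1 + m1), (l2 + m2); repeat split; [| |ring].
- eapply C_cv_ext; [intros n; symmetry; apply Csum_add|now apply C_cv_add].
- eapply C_cv_ext; [intros n; symmetry; apply Csum_add|now apply C_cv_add].
Qed.

Lemma bicv_scal (c : Cplx) (f : Z -> Cplx) (l : Cplx) :
  bicv f l -> bicv (fun r => c * f r) (c * l).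
Proof.
intros (l1 & l2 & h1 & h2 & ->).
exists (c * l1), (c * l2); repeat split; [| |ring].
- eapply C_cv_ext; [intros n; symmetry; apply Csum_scal|].
  apply C_cv_mul; auto using C_cv_const.
- eapply C_cv_ext; [intros n; symmetry; apply Csum_scal|].
  apply C_cv_mul; auto using C_cv_const.
Qed.

Lemma bicv_sub (f g : Z -> Cplx) (l m : Cplx) :
  bicv f l -> bicv g m -> bicv (fun r => f r - g r) (l - m).
Proof.
intros hf hg. apply bicv_ext with (fun r => f r + - (1) * g r); [intros; ring|].
replace (l - m) with (l + - (1) * m) by ring. apply bicv_add; auto using bicv_scal.
Qed.

Lemma bicv_unique (f : Z -> Cplx) (l m : Cplx) : bicv f l -> bicv f m -> l = m.
Proof. intros hl hm. now rewrite <- (bisum_eq f l), <- (bisum_eq f m). Qed.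

(** The shift only moves the term [f 0] from the nonnegative half to the negative one. This makes
    every telescoping bilateral sum vanish. *)
Lemma bicv_succ (f : Z -> Cplx) (l : Cplx) : bicv f l -> bicv (fun r => f (r + 1)%Z) l.
Proof.
intros (l1 & l2 & h1 & h2 & ->). exists (l1 - f 0%Z), (l2 + f 0%Z); repeat split; [| |ring].
- apply C_cv_succ in h1.
  eapply C_cv_ext; [|exact (C_cv_sub _ _ _ _ h1 (C_cv_const (f 0%Z)))].
  intros n; cbv beta. rewrite Csum_shift; simpl Z.of_nat.
  rewrite (Csum_ext (fun k => f (Z.of_nat (S k))) (fun k => f (Z.of_nat k + 1)%Z));
    [ring|intros k; replace (Z.of_nat (S k)) with (Z.of_nat k + 1)%Z by lia; reflexivity].
- apply C_cv_succ.
  eapply C_cv_ext; [|exact (C_cv_add _ _ _ _ h2 (C_cv_const (f 0%Z)))].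
  intros n; cbv beta. rewrite (Csum_shift (fun k => f (- Z.of_nat (S k) + 1)%Z)).
  rewrite (Csum_ext (fun k => f (- Z.of_nat (S (S k)) + 1)%Z) (fun k => f (- Z.of_nat (S k))%Z));
    [|intros k; replace (- Z.of_nat (S (S k)) + 1)%Z with (- Z.of_nat (S k))%Z by lia; reflexivity].
  replace (- Z.of_nat 1 + 1)%Z with 0%Z by lia. ring.
Qed.

Lemma C_cv_eventually_const (u : nat -> Cplx) (l : Cplx) (N : nat) :
  (forall n, (N <= n)%nat -> u n = l) -> C_cv u l.
Proof.
intros H eps he; exists N; intros n hn. rewrite H by auto.
replace (l - l) with 0 by ring. now rewrite Cnorm0.
Qed.

Lemma bicv_two (f : Z -> Cplx) :
  (forall r, r <> 0%Z -> r <> 1%Z -> f r = 0) -> bicv f (f 0%Z + f 1%Z).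
Proof.
intros H. exists (f 0%Z + f 1%Z), 0; repeat split; [| |ring].
- apply C_cv_eventually_const with 2%nat. intros n hn.
  induction hn as [|n hn IH]; [simpl; ring|]. simpl. rewrite IH, (H (Z.of_nat n)) by lia. ring.
- apply C_cv_eventually_const with O. intros n _.
  induction n; [reflexivity|].
  change (Csum (fun k => f (- Z.of_nat (S k))%Z) n + f (- Z.of_nat (S n))%Z = 0).
  rewrite IHn, H by lia. ring.
Qed.

Lemma bisum_two (f : Z -> Cplx) :
  (forall r, r <> 0%Z -> r <> 1%Z -> f r = 0) -> bisum f = f 0%Z + f 1%Z.
Proof. intros H. now apply bisum_eq, bicv_two. Qed.

(** * Infinite products and their growth *)

Lemma one_add_le_exp (x : R) : (1 + x <= exp x)%R.
Proof.
destruct (Req_dec x 0) as [->|h]; [rewrite exp_0; lra|].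
apply Rlt_le, exp_ineq1; auto.
Qed.

Lemma exp_le (x y : R) : (x <= y)%R -> (exp x <= exp y)%R.
Proof. intros [h| ->]; [now apply Rlt_le, exp_increasing|apply Rle_refl]. Qed.

Lemma powerRZ_mul_nat (x : R) (a : Z) (n : nat) :
  x <> 0%R -> powerRZ x (a * Z.of_nat n) = (powerRZ x a ^ n)%R.
Proof.
intros hx; induction n; [now rewrite Z.mul_0_r|].
replace (a * Z.of_nat (S n))%Z with (a + a * Z.of_nat n)%Z by lia.
now rewrite powerRZ_add, IHn.
Qed.

Section QPochhammer.

Context (p : Cplx) (hp : (Cnorm p < 1)%R).

Let rho_ge0 : (0 <= Cnorm p)%R := Cnorm_ge0 p.

(** Majorant of the product of all [1 + x |p|^j], from [1 + t <= exp t] and the geometric series. *)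
Definition qpbound (x : R) : R := exp (x / (1 - Cnorm p)).

Lemma qpbound_gt0 (x : R) : (0 < qpbound x)%R.
Proof. apply exp_pos. Qed.

Lemma qpbound_le (x y : R) : (x <= y)%R -> (qpbound x <= qpbound y)%R.
Proof.
intros h. apply exp_le, Rmult_le_compat_r; auto.
apply Rlt_le, Rinv_0_lt_compat; lra.
Qed.

Lemma geom_partial_le (x : R) (n : nat) :
  (0 <= x)%R -> (x * (1 - Cnorm p ^ n) / (1 - Cnorm p) <= x / (1 - Cnorm p))%R.
Proof.
intros hx. apply Rmult_le_compat_r; [apply Rlt_le, Rinv_0_lt_compat; lra|].
generalize (pow_le (Cnorm p) n rho_ge0); nra.
Qed.

Lemma qpoch_norm_le (u : Cplx) (n : nat) : (Cnorm (qpoch u p n) <= qpbound (Cnorm u))%R.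
Proof.
(* The induction goes through only with the partial geometric sum in the exponent; it is replaced by
   the full sum at the end. *)
apply Rle_trans with (exp (Cnorm u * (1 - Cnorm p ^ n) / (1 - Cnorm p)));
  [|apply exp_le, geom_partial_le, Cnorm_ge0].
induction n; simpl qpoch.
- rewrite Cnorm1. simpl. replace (Cnorm u * (1 - 1) / (1 - Cnorm p))%R with 0%R by (field; lra).
  rewrite exp_0; lra.
- rewrite Cnorm_mul.
  replace (Cnorm u * (1 - Cnorm p ^ S n) / (1 - Cnorm p))%R
    with (Cnorm u * (1 - Cnorm p ^ n) / (1 - Cnorm p) + Cnorm u * Cnorm p ^ n)%R
    by (simpl; field; lra).
  rewrite exp_plus. apply Rmult_le_compat; auto using Cnorm_ge0.
  eapply Rle_trans; [|apply one_add_le_exp].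
  eapply Rle_trans; [apply Cnorm_sub|].
  rewrite Cnorm1, Cnorm_mul, Cnorm_pow. lra.
Qed.

(** Turns partial products into partial sums, so that the tools for series give both the convergence
    of the product and its distance to 1. *)
Lemma qpoch_telescope (u : Cplx) (n : nat) :
  qpoch u p n = 1 + Csum (fun j => - (qpoch u p j * u * Cpow p j)) n.
Proof.
induction n; simpl; [ring|].
replace (Csum (fun j => - (qpoch u p j * u * Cpow p j)) n) with (qpoch u p n - 1)
  by (rewrite IHn; ring). ring.
Qed.

Lemma qpoch_incr_le (u : Cplx) (j : nat) :
  (Cnorm (- (qpoch u p j * u * Cpow p j)) <= qpbound (Cnorm u) * Cnorm u * Cnorm p ^ j)%R.
Proof.
rewrite Cnorm_opp, !Cnorm_mul, Cnorm_pow.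
apply Rmult_le_compat_r; [now apply pow_le|].
apply Rmult_le_compat_r; [apply Cnorm_ge0|apply qpoch_norm_le].
Qed.

Lemma qpoch_cv (u : Cplx) : C_cv (qpoch u p) (qpinf u p).
Proof.
destruct (Csum_cv _ _ (Cnorm p) (conj rho_ge0 hp) (qpoch_incr_le u)) as [l hl].
unfold qpinf. rewrite (Clim_eq _ (1 + l)).
all: apply C_cv_ext with (1 := fun n => eq_sym (qpoch_telescope u n)).
all: apply C_cv_add; auto using C_cv_const.
Qed.

Lemma qpinf_norm_le (u : Cplx) (x : R) : (Cnorm u <= x)%R -> (Cnorm (qpinf u p) <= qpbound x)%R.
Proof.
intros h. apply Rle_trans with (qpbound (Cnorm u)); [|now apply qpbound_le].
apply C_cv_le with (1 := qpoch_cv u). apply qpoch_norm_le.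
Qed.

Lemma qpinf_sub1_le (u : Cplx) :
  (Cnorm (qpinf u p - 1) <= qpbound (Cnorm u) * Cnorm u / (1 - Cnorm p))%R.
Proof.
assert (h : C_cv (Csum (fun j => - (qpoch u p j * u * Cpow p j))) (qpinf u p - 1)).
{ apply C_cv_ext with (fun n => qpoch u p n - 1).
  - intros n. rewrite (qpoch_telescope u n) at 1. ring.
  - apply C_cv_sub; [apply qpoch_cv|apply C_cv_const]. }
apply (Csum_lim_tail _ _ _ _ O (conj rho_ge0 hp) (qpoch_incr_le u)) in h.
simpl in h. rewrite Rmult_1_r in h.
replace (qpinf u p - 1) with (qpinf u p - 1 - 0) by ring. exact h.
Qed.

Lemma qpoch_head (u : Cplx) (n : nat) : qpoch u p (S n) = (1 - u) * qpoch (u * p) p n.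
Proof.
induction n; [simpl; ring|].
change (qpoch u p (S (S n))) with (qpoch u p (S n) * (1 - u * Cpow p (S n))).
rewrite IHn; simpl; ring.
Qed.

Lemma qpinf_rec (u : Cplx) : qpinf u p = (1 - u) * qpinf (u * p) p.
Proof.
apply C_cv_unique with (fun n => qpoch u p (S n)).
- apply (C_cv_succ (qpoch u p)), qpoch_cv.
- apply C_cv_ext with (1 := fun n => eq_sym (qpoch_head u n)).
  apply C_cv_mul; [apply C_cv_const|apply qpoch_cv].
Qed.

Lemma qpinf_qpoch (u : Cplx) (n : nat) : qpinf u p = qpoch u p n * qpinf (u * Cpow p n) p.
Proof.
induction n; simpl; [replace (u * 1) with u by ring; ring|].
rewrite IHn at 1. rewrite (qpinf_rec (u * Cpow p n)).
replace (u * Cpow p n * p) with (u * (Cpow p n * p)) by ring. ring.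
Qed.

Lemma qpinf_eq0 (u : Cplx) (n : nat) : u * Cpow p n = 1 -> qpinf u p = 0.
Proof. intros h. rewrite (qpinf_qpoch u (S n)); simpl. rewrite h; ring. Qed.

(** The arguments met along the diagonal [(c p^k, d p^k)] are of this size, and [qpinf] tends to 1
    on them. *)
Definition small (u : nat -> Cplx) : Prop :=
  exists A, forall k, (Cnorm (u k) <= A * Cnorm p ^ k)%R.

Lemma small_pow : small (Cpow p).
Proof. exists 1%R; intros k; rewrite Cnorm_pow; lra. Qed.

Lemma small_mul_l (u v : nat -> Cplx) (M : R) :
  (forall k, (Cnorm (u k) <= M)%R) -> small v -> small (fun k => u k * v k).
Proof.
intros hu [A hv]. exists (M * A)%R; intros k. rewrite Cnorm_mul, Rmult_assoc.
apply Rmult_le_compat; auto using Cnorm_ge0.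
Qed.

Lemma small_bounded (u : nat -> Cplx) : small u -> exists M, forall k, (Cnorm (u k) <= M)%R.
Proof.
intros [A hA]. exists A; intros k. apply Rle_trans with (1 := hA k).
assert (0 <= A)%R by (specialize (hA O); simpl in hA; generalize (Cnorm_ge0 (u O)); lra).
assert (Cnorm p ^ k <= 1)%R by (rewrite <- (pow1 k); apply pow_incr; lra).
generalize (pow_le (Cnorm p) k rho_ge0); nra.
Qed.

Lemma small_const_l (c : Cplx) (v : nat -> Cplx) : small v -> small (fun k => c * v k).
Proof. apply small_mul_l with (Cnorm c); intros; apply Rle_refl. Qed.

Lemma small_const_r (c : Cplx) (v : nat -> Cplx) : small v -> small (fun k => v k * c).
Proof.
intros h. destruct (small_const_l c v h) as [A hA]. exists A; intros k.
rewrite Cnorm_mul, Rmult_comm, <- Cnorm_mul. apply hA.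
Qed.

Lemma small_mul (u v : nat -> Cplx) : small u -> small v -> small (fun k => u k * v k).
Proof. intros hu hv. destruct (small_bounded u hu) as [M hM]. now apply small_mul_l with M. Qed.

Lemma small_cv (u : nat -> Cplx) : small u -> C_cv u 0.
Proof.
intros [A hA]. apply C_cv_squeeze with (fun k => A * Cnorm p ^ k)%R.
- intros n. replace (u n - 0) with (u n) by ring. apply hA.
- now apply is_lim_seq_geom0.
Qed.

Lemma qpinf_cv1 (u : nat -> Cplx) : small u -> C_cv (fun k => qpinf (u k) p) 1.
Proof.
intros hu. destruct (small_bounded u hu) as [M hM]. destruct hu as [A hA].
apply C_cv_squeeze with (fun k => qpbound M / (1 - Cnorm p) * A * Cnorm p ^ k)%R.
- intros k. eapply Rle_trans; [apply qpinf_sub1_le|].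
  replace (qpbound M / (1 - Cnorm p) * A * Cnorm p ^ k)%R
    with (qpbound M * (A * Cnorm p ^ k) / (1 - Cnorm p))%R by (field; lra).
  apply Rmult_le_compat_r; [apply Rlt_le, Rinv_0_lt_compat; lra|].
  apply Rmult_le_compat; auto using Cnorm_ge0, qpbound_le.
  apply Rlt_le, qpbound_gt0.
- now apply is_lim_seq_geom0.
Qed.

(** If the infinite product vanished while no finite one does, [qpinf (u p^n)] would be 0 for every
    [n], against its limit 1. *)
Lemma qpinf_neq0 (u : Cplx) : (forall n, u * Cpow p n <> 1) -> qpinf u p <> 0.
Proof.
intros hu h0.
assert (H : forall n, qpoch u p n <> 0).
{ induction n; [apply Cone_neq0|]. apply Cmul_neq0; auto.
  intros h; apply (hu n), eq_sym, Csub_eq0, h. }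
assert (h : C_cv (fun n => qpinf (u * Cpow p n) p) 0).
{ apply C_cv_ext with (2 := C_cv_const 0). intros n.
  rewrite (qpinf_qpoch u n) in h0. destruct (Cmul_eq0 _ _ h0) as [e|e]; auto.
  now elim (H n). }
apply Cone_neq0. apply C_cv_unique with (2 := h).
apply qpinf_cv1, small_const_l, small_pow.
Qed.

End QPochhammer.

(** * Growth of the products along the powers of p *)

Section QGrowth.

Context (q : Cplx) (hq0 : q <> 0) (hq : (Cnorm q < 1)%R).

Local Notation p := (q * q).
Local Notation sigma := (Cnorm q).

Lemma Cnorm_sqr_lt1 : (Cnorm p < 1)%R.
Proof. rewrite Cnorm_mul. generalize (Cnorm_ge0 q); nra. Qed.

Lemma sqr_neq0 : p <> 0.
Proof. now apply Cmul_neq0. Qed.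

(* The factors 1 - u p^(-j), j <= n, are bounded by x rho^(-j) (1 + rho^j / x). *)
Lemma qpinf_neg_le (x : R) (u : Cplx) (n : nat) : (0 < x)%R -> (Cnorm u <= x)%R ->
  (Cnorm (qpinf (u * CpowZ p (- Z.of_nat n)) p)
   <= qpbound p x * qpbound p (/ x) * (x / sigma) ^ n
      * powerRZ sigma (-1 * (Z.of_nat n * Z.of_nat n)))%R.
Proof.
intros hx hu.
assert (hs := Cnorm_gt0 q hq0). assert (hp := Cnorm_sqr_lt1). assert (hp0 := sqr_neq0).
set (rho := Cnorm p) in *. assert (hr : rho = (sigma * sigma)%R) by apply Cnorm_mul.
assert (hr0 : (0 < rho)%R) by (rewrite hr; now apply Rmult_lt_0_compat).
apply Rle_trans with (qpbound p x * exp (/ x * (1 - rho ^ n) / (1 - rho))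
   * (x / sigma) ^ n * powerRZ sigma (-1 * (Z.of_nat n * Z.of_nat n)))%R.
- induction n.
  + replace (u * CpowZ p (- Z.of_nat 0)) with u by (simpl; ring).
    simpl. replace (/ x * (1 - 1) / (1 - rho))%R with 0%R by (field; lra).
    rewrite exp_0, !Rmult_1_r. now apply qpinf_norm_le.
  + rewrite qpinf_rec by auto.
    replace (u * CpowZ p (- Z.of_nat (S n)) * p) with (u * CpowZ p (- Z.of_nat n)).
    2:{ replace (- Z.of_nat n)%Z with (- Z.of_nat (S n) + 1)%Z by lia.
        rewrite CpowZ_succ by auto. ring. }
    rewrite Cnorm_mul.
    assert (hrn : (0 < rho ^ n)%R) by now apply pow_lt.
    assert (h1 : (Cnorm (1 - u * CpowZ p (- Z.of_nat (S n)))
       <= x / rho ^ S n * exp (/ x * rho ^ n))%R).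
    { eapply Rle_trans; [apply Cnorm_sub|]. rewrite Cnorm1, Cnorm_mul, CpowZ_neg.
      rewrite Cnorm_inv, Cnorm_pow by (now apply Cpow_neq0). fold rho.
      assert (h2 := pow_lt rho (S n) hr0).
      apply Rle_trans with (x / rho ^ S n * (1 + / x * rho ^ n))%R.
      - apply Rle_trans with (1 + x * / (rho ^ S n))%R.
        + apply Rplus_le_compat_l, Rmult_le_compat_r; auto.
          apply Rlt_le, Rinv_0_lt_compat; auto.
        + replace (x / rho ^ S n * (1 + / x * rho ^ n))%R with (/ rho + x * / rho ^ S n)%R
            by (simpl; field; lra).
          apply Rplus_le_compat_r. rewrite <- Rinv_1 at 1. apply Rinv_le_contravar; lra.
      - apply Rmult_le_compat_l; [|apply one_add_le_exp].
        apply Rmult_le_pos; [lra|]. apply Rlt_le, Rinv_0_lt_compat; auto. }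
    eapply Rle_trans; [apply Rmult_le_compat; [apply Cnorm_ge0|apply Cnorm_ge0|exact h1|exact IHn]|].
    (* The [rho^(-j)] for 1 <= j <= n multiply to [sigma^(-n^2-n)]. The linear part sits in
       [(x / sigma)^n], so the step from n to n+1 adds [2n+1] to the square. *)
    replace (-1 * (Z.of_nat (S n) * Z.of_nat (S n)))%Z
      with (-1 * (Z.of_nat n * Z.of_nat n) + - (Z.of_nat (2 * n + 1)))%Z by lia.
    rewrite powerRZ_add by lra. rewrite (powerRZ_neg' _ (Z.of_nat (2 * n + 1))), <- pow_powerRZ.
    assert (hsn := pow_lt sigma (2 * n + 1) hs).
    assert (he : exp (/ x * (1 - rho ^ S n) / (1 - rho))
      = (exp (/ x * (1 - rho ^ n) / (1 - rho)) * exp (/ x * rho ^ n))%R).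
    { rewrite <- exp_plus. f_equal. simpl; field; lra. }
    rewrite he.
    replace (rho ^ S n)%R with (sigma ^ (2 * n + 1) * sigma)%R
      by (rewrite hr, pow_add, pow_mult; simpl; rewrite Rmult_1_r; ring).
    apply Req_le. simpl ((x / sigma) ^ S n)%R. field. lra.
- assert (0 <= / x)%R by (apply Rlt_le, Rinv_0_lt_compat; lra).
  apply Rmult_le_compat_r; [apply powerRZ_le; auto|].
  apply Rmult_le_compat_r; [apply pow_le, Rlt_le, Rdiv_lt_0_compat; auto|].
  apply Rmult_le_compat_l; [apply Rlt_le, qpbound_gt0|].
  apply exp_le, geom_partial_le; auto.
Qed.

(** A growth profile in the direction [e] (1 or -1), uniform in [k]: geometric rate [K] and Gaussian
    order [s]. Under products the rates multiply and the orders add, so summability becomes a count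
    of orders. *)
Definition gbound (e s : Z) (K : R) (f : nat -> Z -> Cplx) : Prop :=
  (0 <= K)%R /\ exists C, (0 <= C)%R /\ forall k n,
    (Cnorm (f k (e * Z.of_nat n)%Z) <= C * K ^ n * powerRZ sigma (s * (Z.of_nat n * Z.of_nat n)))%R.

Lemma gbound_mul e s t K L f g : gbound e s K f -> gbound e t L g ->
  gbound e (s + t) (K * L) (fun k r => f k r * g k r).
Proof.
intros [hK [C [hC hf]]] [hL [D [hD hg]]]. split; [now apply Rmult_le_pos|].
exists (C * D)%R; split; [now apply Rmult_le_pos|]. intros k n.
rewrite Cnorm_mul, Z.mul_add_distr_r, powerRZ_add, Rpow_mult_distr
  by (generalize (Cnorm_gt0 q hq0); lra).
eapply Rle_trans; [apply Rmult_le_compat; [apply Cnorm_ge0|apply Cnorm_ge0|apply hf|apply hg]|].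
apply Req_le; ring.
Qed.

Lemma gbound_ext e s K f g : (forall k r, f k r = g k r) -> gbound e s K f -> gbound e s K g.
Proof.
intros h [hK [C [hC hf]]]. split; auto. exists C; split; auto. intros; rewrite <- h; auto.
Qed.

Lemma gbound_bounded e M f : (forall k n, (Cnorm (f k (e * Z.of_nat n)%Z) <= M)%R) -> gbound e 0 1 f.
Proof.
intros h. split; [lra|]. exists M; split.
- generalize (h O O) (Cnorm_ge0 (f O (e * Z.of_nat 0)%Z)); lra.
- intros k n. rewrite pow1; simpl. rewrite !Rmult_1_r. apply h.
Qed.

Lemma gbound_pow e x a : x <> 0 -> gbound e 0 (powerRZ (Cnorm x) (a * e)) (fun _ r => CpowZ x (a * r)).
Proof.
intros hx. assert (h := Cnorm_gt0 x hx). split; [now apply powerRZ_le|].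
exists 1%R; split; [lra|]. intros _ n.
rewrite Cnorm_powZ, Z.mul_assoc, powerRZ_mul_nat by (auto; lra).
simpl; lra.
Qed.

Lemma gbound_gauss e a b : (e * e = 1)%Z ->
  gbound e a (powerRZ sigma (b * e)) (fun _ r => CpowZ q (a * (r * r) + b * r)).
Proof.
intros he. assert (h := Cnorm_gt0 q hq0). split; [now apply powerRZ_le|].
exists 1%R; split; [lra|]. intros _ n.
rewrite Cnorm_powZ, powerRZ_add by (auto; lra).
replace (a * (e * Z.of_nat n * (e * Z.of_nat n)))%Z
  with (a * ((e * e) * (Z.of_nat n * Z.of_nat n)))%Z by ring.
rewrite he, Z.mul_1_l, (Z.mul_assoc b), powerRZ_mul_nat by lra.
apply Req_le; ring.
Qed.

Lemma Cnorm_pow_le1 (n : nat) : (Cnorm (Cpow p n) <= 1)%R.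
Proof.
rewrite Cnorm_pow, <- (pow1 n). apply pow_incr. split; [apply Cnorm_ge0|].
apply Rlt_le, Cnorm_sqr_lt1.
Qed.

Lemma gbound_qpinf_up x u : (forall k, (Cnorm (u k) <= x)%R) ->
  gbound 1 0 1 (fun k r => qpinf (u k * CpowZ p r) p).
Proof.
intros hu. apply gbound_bounded with (qpbound p x). intros k n.
rewrite Z.mul_1_l, CpowZ_nat. apply qpinf_norm_le; [apply Cnorm_sqr_lt1|].
rewrite Cnorm_mul. generalize (Cnorm_pow_le1 n) (hu k) (Cnorm_ge0 (u k)) (Cnorm_ge0 (Cpow p n)); nra.
Qed.

Lemma gbound_qpinf_down x u : (0 < x)%R -> (forall k, (Cnorm (u k) <= x)%R) ->
  gbound (-1) (-1) (x / sigma) (fun k r => qpinf (u k * CpowZ p r) p).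
Proof.
intros hx hu. assert (h := Cnorm_gt0 q hq0). split; [now apply Rlt_le, Rdiv_lt_0_compat|].
exists (qpbound p x * qpbound p (/ x))%R; split.
- apply Rlt_le, Rmult_lt_0_compat; apply qpbound_gt0.
- intros k n. replace (-1 * Z.of_nat n)%Z with (- Z.of_nat n)%Z by ring.
  now apply qpinf_neg_le.
Qed.

Lemma gbound_flip s K f :
  gbound (-1) s K f -> gbound 1 s K (fun k r => f k (- r)%Z).
Proof.
intros [hK [C [hC hf]]]. split; auto. exists C; split; auto. intros k n.
replace (- (1 * Z.of_nat n))%Z with (-1 * Z.of_nat n)%Z by ring. auto.
Qed.

Lemma gbound_flip' s K f :
  gbound 1 s K f -> gbound (-1) s K (fun k r => f k (- r)%Z).
Proof.
intros [hK [C [hC hf]]]. split; auto. exists C; split; auto. intros k n.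
replace (- (-1 * Z.of_nat n))%Z with (1 * Z.of_nat n)%Z by ring. auto.
Qed.

Definition geom_dom (e : Z) (f : nat -> Z -> Cplx) : Prop :=
  exists M K, (0 <= K < 1)%R /\ forall k n, (Cnorm (f k (e * Z.of_nat n)%Z) <= M * K ^ n)%R.

(** The borderline order, met only in G as r tends to +oo: the rate itself has to be below 1. *)
Lemma gbound_geom e s K f : s = 0%Z -> (K < 1)%R -> gbound e s K f -> geom_dom e f.
Proof.
intros -> hK [hK0 [C [hC hf]]]. exists C, K; split; [lra|]. intros k n.
specialize (hf k n). simpl in hf. now rewrite Rmult_1_r in hf.
Qed.

(** The left side is [(K sigma^n)^n], and [K sigma^n] is below 1/2 from some [N] on; the constant
    [(2 (K + 1))^N] covers the smaller [n]. *)
Lemma pow_sqr_le_geom (K : R) : (0 <= K)%R ->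
  exists C, (0 <= C)%R /\ forall n, (K ^ n * sigma ^ (n * n) <= C * (/ 2) ^ n)%R.
Proof.
intros hK. assert (h := Cnorm_gt0 q hq0).
assert (h0 := is_lim_seq_geom0 sigma K (conj (Rlt_le _ _ h) hq)).
apply is_lim_seq_spec in h0.
destruct (h0 (mkposreal (/ 2) ltac:(lra))) as [N hN]. simpl in hN.
exists ((2 * (K + 1)) ^ N)%R.
assert (h1 : (1 <= (2 * (K + 1)) ^ N)%R) by (apply pow_R1_Rle; lra).
split; [lra|]. intros n. rewrite pow_mult, <- Rpow_mult_distr.
assert (hsn := pow_lt sigma n h).
assert (hs1 : (sigma ^ n <= 1)%R) by (rewrite <- (pow1 n); apply pow_incr; lra).
destruct (Nat.le_gt_cases N n) as [hn|hn].
- specialize (hN n hn). rewrite Rminus_0_r in hN. apply Rabs_def2 in hN.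
  apply Rle_trans with (1 * (/ 2) ^ n)%R.
  + rewrite Rmult_1_l. apply pow_incr; split; [apply Rmult_le_pos; lra|lra].
  + apply Rmult_le_compat_r; [apply pow_le; lra|auto].
- apply Rle_trans with ((2 * (K + 1)) ^ n * (/ 2) ^ n)%R.
  + rewrite <- Rpow_mult_distr. apply pow_incr; split; [apply Rmult_le_pos; lra|].
    replace (2 * (K + 1) * / 2)%R with (K + 1)%R by field. nra.
  + apply Rmult_le_compat_r; [apply pow_le; lra|]. apply Rle_pow; [lra|lia].
Qed.

Lemma gbound_gauss_geom e s K f : (1 <= s)%Z -> gbound e s K f -> geom_dom e f.
Proof.
intros hs [hK [C [hC hf]]]. destruct (pow_sqr_le_geom K hK) as [D [hD hKD]].
assert (h := Cnorm_gt0 q hq0).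
exists (C * D)%R, (/ 2)%R; split; [lra|]. intros k n.
eapply Rle_trans; [apply hf|]. rewrite !Rmult_assoc. apply Rmult_le_compat_l; auto.
eapply Rle_trans; [|apply hKD]. apply Rmult_le_compat_l; [now apply pow_le|].
replace (s * (Z.of_nat n * Z.of_nat n))%Z
  with (Z.of_nat (n * n) + Z.of_nat (Z.to_nat (s - 1) * (n * n)))%Z by nia.
rewrite powerRZ_add, <- !pow_powerRZ by lra.
assert (h1 := pow_lt sigma (n * n) h).
assert (h2 : (sigma ^ (Z.to_nat (s - 1) * (n * n)) <= 1)%R)
  by (rewrite <- (pow1 (Z.to_nat (s - 1) * (n * n))); apply pow_incr; lra).
nra.
Qed.

End QGrowth.

(** * Dominated bilateral sums and their limits *)

Lemma geom_dom_bicv f k : geom_dom 1 f -> geom_dom (-1) f -> bicv (f k) (bisum (f k)).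
Proof.
intros (M & K & hK & hM) (M' & K' & hK' & hM').
destruct (Csum_cv (fun n => f k (Z.of_nat n)) M K hK) as [l hl].
{ intros n. rewrite <- (Z.mul_1_l (Z.of_nat n)). apply hM. }
destruct (Csum_cv (fun n => f k (- Z.of_nat (S n))%Z) (M' * K') K' hK') as [l' hl'].
{ intros n. replace (- Z.of_nat (S n))%Z with (-1 * Z.of_nat (S n))%Z by ring.
  rewrite Rmult_assoc. apply hM'. }
assert (H : bicv (f k) (l + l')) by (exists l, l'; auto).
now rewrite (bisum_eq _ _ H).
Qed.

Lemma bisum_tannery f g : geom_dom 1 f -> geom_dom (-1) f ->
  (forall r, C_cv (fun k => f k r) (g r)) -> C_cv (fun k => bisum (f k)) (bisum g).
Proof.
intros h1 h2 hg.
assert (hgd : forall e, geom_dom e f -> geom_dom e (fun _ => g)).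
{ intros e (M & K & hK & hM). exists M, K; split; auto. intros _ n.
  apply C_cv_le with (1 := hg _). intros k; apply hM. }
destruct (geom_dom_bicv (fun _ => g) O (hgd _ h1) (hgd _ h2)) as (m1 & m2 & hm1 & hm2 & ->).
set (L1 k := Clim (Csum (fun n => f k (Z.of_nat n)))).
set (L2 k := Clim (Csum (fun n => f k (- Z.of_nat (S n))%Z))).
assert (hL : forall k, C_cv (Csum (fun n => f k (Z.of_nat n))) (L1 k)
  /\ C_cv (Csum (fun n => f k (- Z.of_nat (S n))%Z)) (L2 k)).
{ intros k. destruct (geom_dom_bicv f k h1 h2) as (l1 & l2 & H1 & H2 & _).
  unfold L1, L2. now rewrite (Clim_eq _ _ H1), (Clim_eq _ _ H2). }
assert (hL1 := fun k => proj1 (hL k)). assert (hL2 := fun k => proj2 (hL k)).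
apply C_cv_ext with (fun k => L1 k + L2 k).
{ intros k. symmetry. apply bisum_eq. exists (L1 k), (L2 k); auto. }
apply C_cv_add.
- destruct h1 as (M & K & hK & hM).
  apply Csum_tannery with (5 := hm1) (4 := hL1) (1 := hK) (M := M).
  + intros k n. rewrite <- (Z.mul_1_l (Z.of_nat n)). apply hM.
  + intros n; apply hg.
- destruct h2 as (M & K & hK & hM).
  apply Csum_tannery with (5 := hm2) (4 := hL2) (1 := hK) (M := (M * K)%R).
  + intros k n. replace (- Z.of_nat (S n))%Z with (-1 * Z.of_nat (S n))%Z by ring.
    rewrite Rmult_assoc. apply hM.
  + intros n; apply hg.
Qed.

(** * The contiguous relations *)

Section Contiguous.

Context (p y c d : Cplx) (hp : (Cnorm p < 1)%R) (hc : c <> 0) (hd : d <> 0) (hp0 : p <> 0).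

(* X i j stands for X(c p^i, d p^j); U is the common divided difference of X in c and in d. *)
Definition contiguous (X U : nat -> nat -> Cplx) : Prop :=
  (forall i j, X i j - X (S i) j = c * Cpow p i * U i j) /\
  (forall i j, X i j - X i (S j) = d * Cpow p j * U i j) /\
  (forall i j, U i j - U i (S j) = y * p * (d * Cpow p j) * X (S i) (S j)).

Lemma contiguous_sub X U X' U' : contiguous X U -> contiguous X' U' ->
  contiguous (fun i j => X i j - X' i j) (fun i j => U i j - U' i j).
Proof.
intros (h1 & h2 & h3) (h1' & h2' & h3'). repeat split; intros i j.
- transitivity ((X i j - X (S i) j) - (X' i j - X' (S i) j)); [ring|rewrite h1, h1'; ring].
- transitivity ((X i j - X i (S j)) - (X' i j - X' i (S j))); [ring|rewrite h2, h2'; ring].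
- transitivity ((U i j - U i (S j)) - (U' i j - U' i (S j))); [ring|rewrite h3, h3'; ring].
Qed.

Lemma contiguous_scal a X U : contiguous X U ->
  contiguous (fun i j => a * X i j) (fun i j => a * U i j).
Proof.
intros (h1 & h2 & h3). repeat split; intros i j.
- transitivity (a * (X i j - X (S i) j)); [ring|rewrite h1; ring].
- transitivity (a * (X i j - X i (S j))); [ring|rewrite h2; ring].
- transitivity (a * (U i j - U i (S j))); [ring|rewrite h3; ring].
Qed.

(** The mixed second difference of [X] can be taken in either order. Equating the two results
    carries the relation for [U] from the [d] direction to the [c] direction, after cancelling
    [d p^j]. *)
Lemma contiguous_U_left X U : contiguous X U ->
  forall i j, U i j - U (S i) j = y * p * (c * Cpow p i) * X (S i) (S j).
Proof.
intros (h1 & h2 & h3) i j.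
apply Cmul_cancel_l with (d * Cpow p j); [now apply Cmul_neq0, Cpow_neq0|].
transitivity ((X i j - X i (S j)) - (X (S i) j - X (S i) (S j))); [rewrite !h2; ring|].
transitivity ((X i j - X (S i) j) - (X i (S j) - X (S i) (S j))); [ring|].
rewrite !h1. transitivity (c * Cpow p i * (U i j - U i (S j))); [ring|rewrite h3; ring].
Qed.

(** Propagation outward from the corner, the direction opposite to [contiguous_zero]. It follows the
    staircase (n,n), (n,n+1), (n+1,n+1), (n+1,n+2) and has to invert the system, hence the condition
    on [y p c d p^n]. *)
Lemma contiguous_zero_diag X U : contiguous X U ->
  (forall n, y * p * c * d * Cpow p n <> 1) -> X O O = 0 -> U O O = 0 ->
  forall n, X n n = 0 /\ U n n = 0.
Proof.
intros H hy hX hU. assert (h4 := contiguous_U_left X U H). destruct H as (h1 & h2 & h3).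
(* After each half step the next unknown [u] and a value [x] satisfy two homogeneous linear
   equations, whose determinant is [1 - y p c d p^n] up to a unit. *)
assert (solve : forall u x b n, y * p * c * d * Cpow p n <> 1 -> x = - (b * u) ->
  - u = y * p * (c * d * Cpow p n) * Cinv b * x -> b <> 0 -> u = 0).
{ intros u x b n hn -> h hb.
  assert (h' : (1 - y * p * c * d * Cpow p n) * u = 0).
  { transitivity (- (- u - y * p * (c * d * Cpow p n) * Cinv b * - (b * u))); [field; auto|].
    rewrite <- h. ring. }
  destruct (Cmul_eq0 _ _ h') as [e|e]; auto. now elim hn; apply eq_sym, Csub_eq0. }
induction n as [|n [IHX IHU]]; [auto|].
assert (hc' : c * Cpow p n <> 0) by now apply Cmul_neq0, Cpow_neq0.
assert (hd' : d * Cpow p n <> 0) by now apply Cmul_neq0, Cpow_neq0.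
assert (e1 : X n (S n) = 0).
{ replace (X n (S n)) with (X n n - (X n n - X n (S n))) by ring.
  rewrite h2, IHX, IHU; ring. }
assert (e2 : X (S n) (S n) = - (c * Cpow p n * U n (S n))).
{ rewrite <- h1, e1. ring. }
assert (e3 : U n (S n) = 0).
{ apply solve with (n := (n + n)%nat) (2 := e2); auto.
  generalize (h3 n n). rewrite IHU, Cpow_add. intros e.
  transitivity (0 - U n (S n)); [ring|]. rewrite e. field.
  split; auto. now apply Cpow_neq0. }
assert (e4 : X (S n) (S n) = 0) by (rewrite e2, e3; ring).
split; auto.
assert (e5 : X (S n) (S (S n)) = - (d * Cpow p (S n) * U (S n) (S n))).
{ rewrite <- h2, e4. ring. }
apply solve with (n := (n + S n)%nat) (2 := e5); auto.
- generalize (h4 n (S n)). rewrite e3, Cpow_add. intros e.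
  transitivity (0 - U (S n) (S n)); [ring|]. rewrite e. field.
  split; auto. now apply Cpow_neq0.
- now apply Cmul_neq0, Cpow_neq0.
Qed.

(** Going back from (n+1,n+1) to (n,n) enlarges the norm by at most [1 + K rho^n]. The product of
    these factors converges, so a zero limit forces zero at the corner. *)
Lemma contiguous_zero X U : contiguous X U ->
  C_cv (fun n => X n n) 0 -> C_cv (fun n => U n n) 0 -> X O O = 0 /\ U O O = 0.
Proof.
intros H cX cU. assert (h4 := contiguous_U_left X U H). destruct H as (h1 & h2 & h3).
set (rho := Cnorm p) in *. assert (hr0 := Cnorm_ge0 p). fold rho in hr0.
set (s n := (Cnorm (X n n) + Cnorm (U n n))%R).
(* [k] collects the coefficients in the two updates of [U], [m] those in the update of [X]. The
   latter uses values of [U] already updated, of size at most [(1 + k) N]; hence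
   [K = k + m (1 + k)]. *)
set (k := (Cnorm (y * p) * (Cnorm (c * d * p) + Cnorm c + Cnorm d))%R).
set (m := (Cnorm c + Cnorm d)%R).
set (K := (k + m * (1 + k))%R).
assert (hs0 : forall n, (0 <= s n)%R) by (intros n; apply Rplus_le_le_0_compat; apply Cnorm_ge0).
assert (hm : (0 <= m)%R) by (apply Rplus_le_le_0_compat; apply Cnorm_ge0).
assert (hk : (0 <= k)%R).
{ apply Rmult_le_pos; repeat apply Rplus_le_le_0_compat; apply Cnorm_ge0. }
assert (hstep : forall n, (s n <= (1 + K * rho ^ n) * s (S n))%R).
{ intros n. set (e := Cpow p n). set (x := X (S n) (S n)). set (u := U (S n) (S n)).
  set (t := (rho ^ n)%R).
  assert (ht : Cnorm e = t) by apply Cnorm_pow.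
  assert (ht0 : (0 <= t)%R) by now apply pow_le.
  assert (ht1 : (t <= 1)%R) by (unfold t; rewrite <- (pow1 n); apply pow_incr; lra).
  (* The path back is (n+1,n+1), (n+1,n), (n,n). [E1], [E2] and [E3] express [U] at both new points,
     and [X] at the last, through [x] and [u]. *)
  assert (E1 : U (S n) n = u + y * p * (d * e) * (x - c * (p * e) * u)).
  { generalize (h3 (S n) n) (h1 (S n) (S n)). fold e x u. simpl Cpow. fold e. intros a1 a2.
    replace (U (S n) n) with ((U (S n) n - u) + u) by ring. rewrite a1.
    replace (X (S (S n)) (S n)) with (x - (x - X (S (S n)) (S n))) by ring. rewrite a2. ring. }
  assert (E2 : U n n = U (S n) n + y * p * (c * e) * x).
  { generalize (h4 n n). fold e x. intros a.
    replace (U n n) with ((U n n - U (S n) n) + U (S n) n) by ring. rewrite a; ring. }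
  assert (E3 : X n n = x + d * e * U (S n) n + c * e * U n n).
  { generalize (h1 n n) (h2 (S n) n). fold e x. intros a1 a2.
    replace (X n n) with ((X n n - X (S n) n) + (X (S n) n - x) + x) by ring.
    rewrite a1, a2; ring. }
  set (N := (Cnorm x + Cnorm u)%R).
  assert (hx := Cnorm_ge0 x). assert (hu := Cnorm_ge0 u).
  assert (hN : (0 <= N)%R) by (unfold N; lra).
  assert (T : forall a v, (Cnorm v <= N)%R -> (Cnorm (a * (e * v)) <= Cnorm a * (t * N))%R).
  { intros a v hv. rewrite !Cnorm_mul, ht. apply Rmult_le_compat_l; [apply Cnorm_ge0|].
    now apply Rmult_le_compat_l. }
  assert (hv : (Cnorm (e * u) <= N)%R).
  { rewrite Cnorm_mul, ht. unfold N. nra. }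
  assert (B0 : (Cnorm (U (S n) n)
    <= Cnorm u + Cnorm (y * p) * (Cnorm (c * d * p) + Cnorm d) * (t * N))%R).
  { rewrite E1. replace (u + y * p * (d * e) * (x - c * (p * e) * u))
      with (u + (y * p * d * (e * x) - y * p * (c * d * p) * (e * (e * u)))) by ring.
    eapply Rle_trans; [apply Cnorm_add|].
    eapply Rle_trans; [apply Rplus_le_compat_l, Cnorm_sub|].
    assert (a1 := T (y * p * d) x ltac:(unfold N; lra)).
    assert (a2 := T (y * p * (c * d * p)) (e * u) hv).
    rewrite (Cnorm_mul (y * p) d) in a1. rewrite (Cnorm_mul (y * p) (c * d * p)) in a2. lra. }
  assert (hypc : (0 <= Cnorm (y * p) * Cnorm c * (t * N))%R)
    by (repeat apply Rmult_le_pos; auto using Cnorm_ge0).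
  assert (B1 : (Cnorm (U (S n) n) <= Cnorm u + k * (t * N))%R) by (unfold k; lra).
  assert (B2 : (Cnorm (U n n) <= Cnorm u + k * (t * N))%R).
  { rewrite E2. eapply Rle_trans; [apply Cnorm_add|].
    replace (y * p * (c * e) * x) with (y * p * c * (e * x)) by ring.
    assert (a1 := T (y * p * c) x ltac:(unfold N; lra)).
    rewrite (Cnorm_mul (y * p) c) in a1. unfold k. lra. }
  assert (hB : (Cnorm u + k * (t * N) <= (1 + k) * N)%R).
  { assert (k * (t * N) <= k * N)%R by (apply Rmult_le_compat_l; auto; nra).
    unfold N in *. lra. }
  assert (B3 : (Cnorm (X n n) <= Cnorm x + t * (m * ((1 + k) * N)))%R).
  { rewrite E3. eapply Rle_trans; [apply Cnorm_add|].
    eapply Rle_trans; [apply Rplus_le_compat_r, Cnorm_add|].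
    rewrite (Cnorm_mul (d * e)), (Cnorm_mul (c * e)), (Cnorm_mul d), (Cnorm_mul c), ht.
    assert (a1 : (Cnorm d * t * Cnorm (U (S n) n) <= Cnorm d * t * ((1 + k) * N))%R)
      by (apply Rmult_le_compat_l; [apply Rmult_le_pos; auto using Cnorm_ge0|lra]).
    assert (a2 : (Cnorm c * t * Cnorm (U n n) <= Cnorm c * t * ((1 + k) * N))%R)
      by (apply Rmult_le_compat_l; [apply Rmult_le_pos; auto using Cnorm_ge0|lra]).
    unfold m. lra. }
  unfold s. fold x u N. unfold K. fold t. unfold N in *. lra. }
assert (hK : (0 <= K)%R).
{ unfold K. apply Rplus_le_le_0_compat; auto. apply Rmult_le_pos; lra. }
assert (hprod : forall n, (s O <= exp (K * (1 - rho ^ n) / (1 - rho)) * s n)%R).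
{ induction n.
  - simpl. replace (K * (1 - 1) / (1 - rho))%R with 0%R by (field; lra). rewrite exp_0; lra.
  - eapply Rle_trans; [apply IHn|].
    replace (K * (1 - rho ^ S n) / (1 - rho))%R
      with (K * (1 - rho ^ n) / (1 - rho) + K * rho ^ n)%R by (simpl; field; lra).
    rewrite exp_plus, Rmult_assoc. apply Rmult_le_compat_l; [apply Rlt_le, exp_pos|].
    eapply Rle_trans; [apply hstep|]. apply Rmult_le_compat_r; auto. apply one_add_le_exp. }
assert (hlim : is_lim_seq (fun n => qpbound p K * s n)%R 0%R).
{ replace 0%R with (qpbound p K * (0 + 0))%R by ring.
  apply is_lim_seq_mult'; [apply is_lim_seq_const|].
  rewrite <- Cnorm0. apply is_lim_seq_plus'; now apply C_cv_norm. }
assert (h0 : (s O <= 0)%R).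
{ apply (is_lim_seq_le (fun _ => s O) _ (s O) 0%R) with (3 := hlim); [|apply is_lim_seq_const].
  intros n. eapply Rle_trans; [apply hprod|]. apply Rmult_le_compat_r; auto.
  apply exp_le, geom_partial_le; auto. }
unfold s in h0. generalize (Cnorm_ge0 (X O O)) (Cnorm_ge0 (U O O)).
split; apply Cnorm_eq0; lra.
Qed.

End Contiguous.

(** * The three families of terms *)

(** Uniform in the index [k] of the family, as Tannery's theorem requires; a single series is
    treated as a constant family. *)
Definition bigeom (f : nat -> Z -> Cplx) : Prop := geom_dom 1 f /\ geom_dom (-1) f.

Lemma bigeom_bicv f k : bigeom f -> bicv (f k) (bisum (f k)).
Proof. intros [h1 h2]. now apply geom_dom_bicv. Qed.

Lemma bigeom_ext f g : (forall k r, f k r = g k r) -> bigeom f -> bigeom g.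
Proof.
intros h [(M & K & hK & hM) (M' & K' & hK' & hM')].
split; [exists M, K|exists M', K']; split; auto; intros; rewrite <- h; auto.
Qed.

Lemma geom_dom_add e f g : geom_dom e f -> geom_dom e g -> geom_dom e (fun k r => f k r + g k r).
Proof.
intros (M & K & hK & hM) (M' & K' & hK' & hM').
exists (M + M')%R, (Rmax K K'). split; [split; [apply Rle_trans with K; [lra|apply Rmax_l]|now apply Rmax_lub_lt]|].
intros k n. eapply Rle_trans; [apply Cnorm_add|]. rewrite Rmult_plus_distr_r.
assert (0 <= M)%R by (specialize (hM k O); simpl in hM; generalize (Cnorm_ge0 (f k (e * 0)%Z)); lra).
assert (0 <= M')%R by (specialize (hM' k O); simpl in hM'; generalize (Cnorm_ge0 (g k (e * 0)%Z)); lra).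
apply Rplus_le_compat; (eapply Rle_trans; [now auto|]); apply Rmult_le_compat_l; auto;
  apply pow_incr; split; try lra; [apply Rmax_l|apply Rmax_r].
Qed.

Lemma bigeom_add f g : bigeom f -> bigeom g -> bigeom (fun k r => f k r + g k r).
Proof. intros [? ?] [? ?]; split; now apply geom_dom_add. Qed.

Definition bounded (u : nat -> Cplx) : Prop := exists M, forall k, (Cnorm (u k) <= M)%R.

Lemma bounded_const c : bounded (fun _ => c).
Proof. exists (Cnorm c); intros; apply Rle_refl. Qed.

Lemma bounded_mul u v : bounded u -> bounded v -> bounded (fun k => u k * v k).
Proof.
intros [M hM] [N hN]. exists (M * N)%R; intros k. rewrite Cnorm_mul.
apply Rmult_le_compat; auto using Cnorm_ge0.
Qed.

Lemma bounded_opp u : bounded u -> bounded (fun k => - u k).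
Proof. intros [M hM]; exists M; intros; rewrite Cnorm_opp; auto. Qed.

Lemma bounded_pos u : bounded u -> exists x, (0 < x)%R /\ forall k, (Cnorm (u k) <= x)%R.
Proof.
intros [M hM]. exists (M + 1)%R. split.
- generalize (hM O) (Cnorm_ge0 (u O)); lra.
- intros k; generalize (hM k); lra.
Qed.

Section Families.

Context (q y : Cplx) (hq0 : q <> 0) (hq : (Cnorm q < 1)%R) (hy : y <> 0).

Local Notation p := (q * q).
Local Notation sigma := (Cnorm q).
Local Notation P x := (qpinf x p).

Let hp : (Cnorm p < 1)%R := Cnorm_sqr_lt1 q hq.
Let hp0 : p <> 0 := sqr_neq0 q hq0.

Lemma CpowZ_minus1 (r : Z) : CpowZ p (-1 * r) = Cinv (CpowZ p r).
Proof. replace (-1 * r)%Z with (- r)%Z by ring. now apply CpowZ_opp. Qed.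

Lemma gbound_div_up x v : (0 < x)%R -> (forall k, (Cnorm (v k) <= x)%R) ->
  gbound q 1 (-1) (x / sigma) (fun k r => P (v k / CpowZ p r)).
Proof.
intros hx hv.
apply gbound_ext with (fun k r => P (v k * CpowZ p (- r))).
- intros k r. now rewrite CpowZ_opp.
- apply (gbound_flip q _ _ (fun k r => P (v k * CpowZ p r))). now apply gbound_qpinf_down.
Qed.

Lemma gbound_div_down x v : (forall k, (Cnorm (v k) <= x)%R) ->
  gbound q (-1) 0 1 (fun k r => P (v k / CpowZ p r)).
Proof.
intros hv.
apply gbound_ext with (fun k r => P (v k * CpowZ p (- r))).
- intros k r. now rewrite CpowZ_opp.
- apply (gbound_flip' q _ _ (fun k r => P (v k * CpowZ p r))). now apply gbound_qpinf_up with x.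
Qed.

(** The weights [y^r p^(r(r-1))] and [y^(3r) p^(3r^2-4r)], in powers of [q] and in the shapes that
    [gbound_pow] and [gbound_gauss] expect. Their Gaussian orders are 2 and 6. *)
Definition thetaW (r : Z) : Cplx := CpowZ y (1 * r) * CpowZ q (2 * (r * r) + -2 * r).
Definition thetaV (r : Z) : Cplx := CpowZ y (3 * r) * CpowZ q (6 * (r * r) + -8 * r).

Lemma thetaW_succ r : thetaW (r + 1) = thetaW r * y * CpowZ p r * CpowZ p r.
Proof.
unfold thetaW.
replace (1 * (r + 1))%Z with (1 * r + 1)%Z by ring.
replace (2 * ((r + 1) * (r + 1)) + -2 * (r + 1))%Z
  with (2 * (r * r) + -2 * r + (r + r + r + r))%Z by ring.
rewrite CpowZ_succ, !CpowZ_add, CpowZ_mul_base by auto. ring.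
Qed.

Lemma thetaV_succ r : thetaV (r + 1) = thetaV r * (y * y * y)
  * (CpowZ p r * CpowZ p r * CpowZ p r * CpowZ p r * CpowZ p r * CpowZ p r) / p.
Proof.
unfold thetaV.
replace (3 * (r + 1))%Z with (3 * r + 1 + 1 + 1)%Z by ring.
replace (6 * ((r + 1) * (r + 1)) + -8 * (r + 1))%Z
  with (6 * (r * r) + -8 * r + (r + r + r + r + r + r + r + r + r + r + r + r) + -(2))%Z by ring.
rewrite 3!CpowZ_succ by auto. rewrite CpowZ_add by auto. rewrite CpowZ_add by auto.
rewrite !(CpowZ_add q (_ + r) r), (CpowZ_add q r r), CpowZ_opp, CpowZ_mul_base by auto.
replace (CpowZ q 2) with p by (simpl; ring). field. auto.
Qed.

Lemma thetaW_0 : thetaW 0 = 1.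
Proof. unfold thetaW; simpl; ring. Qed.

Lemma thetaV_0 : thetaV 0 = 1.
Proof. unfold thetaV; simpl; ring. Qed.

Lemma thetaW_1 : thetaW 1 = y.
Proof. change 1%Z with (0 + 1)%Z. rewrite thetaW_succ, thetaW_0. simpl; ring. Qed.

Lemma thetaV_1 : thetaV 1 = y * y * y / p.
Proof. change 1%Z with (0 + 1)%Z. rewrite thetaV_succ, thetaV_0. simpl; field; auto. Qed.

(** Computes the profile from the syntax of the term. The norm bound is solved first, by [cycle -1],
    because it determines the radius left open by [eapply]. *)
Ltac gbound_tac :=
  lazymatch goal with
  | |- gbound _ _ _ _ (fun k r => Cmul _ _) => eapply (gbound_mul q hq0); [gbound_tac|gbound_tac]
  | |- gbound _ _ _ _ (fun _ r => CpowZ q (_ + _)) => apply (gbound_gauss q hq0); reflexivity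
  | |- gbound _ _ _ _ (fun _ r => CpowZ _ _) => apply gbound_pow; assumption
  | |- gbound _ 1 _ _ (fun k r => P (_ / _)) => eapply gbound_div_up; cycle -1; [eassumption|..]; assumption
  | |- gbound _ _ _ _ (fun k r => P (_ / _)) => eapply gbound_div_down; cycle -1; [eassumption|..]; assumption
  | |- gbound _ 1 _ _ (fun k r => P _) => eapply gbound_qpinf_up; cycle -1; [eassumption|..]; assumption
  | |- gbound _ _ _ _ (fun k r => P _) => eapply gbound_qpinf_down; cycle -1; [eassumption|..]; assumption
  | |- _ => eapply gbound_bounded; intros; eauto
  end.

(** Order count: 2 from the weight and -1 from the one product that grows in the given direction, so
    1 remains. The factor [p^(m r)] changes only the rate. *)
Lemma bigeom_F b u v m : bounded b -> bounded u -> bounded v ->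
  bigeom (fun k r => b k * (P (u k * CpowZ p r) * P (v k / CpowZ p r))
    * (CpowZ p (m * r) * thetaW r)).
Proof.
intros [B hB] hu hv. destruct (bounded_pos u hu) as (x & hx & hux).
destruct (bounded_pos v hv) as (x' & hx' & hvx). unfold thetaW.
split; (eapply (gbound_gauss_geom q hq0 hq); [|gbound_tac]; apply Z.leb_le; reflexivity).
Qed.

(** Here the weight has order 6 and two products grow in each direction, so order 4 remains. *)
Lemma bigeom_R b u u' v v' m : bounded b -> bounded u -> bounded u' -> bounded v -> bounded v' ->
  bigeom (fun k r => b k * (P (u k * CpowZ p r) * P (u' k * CpowZ p r)
      * P (v k / CpowZ p r) * P (v' k / CpowZ p r))
    * (CpowZ p (m * r) * thetaV r)).
Proof.
intros [B hB] hu hu' hv hv'. destruct (bounded_pos u hu) as (x & hx & hux).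
destruct (bounded_pos v hv) as (z & hz & hvz).
destruct (bounded_pos u' hu') as (x' & hx' & hux').
destruct (bounded_pos v' hv') as (z' & hz' & hvz'). unfold thetaV.
split; (eapply (gbound_gauss_geom q hq0 hq); [|gbound_tac]; apply Z.leb_le; reflexivity).
Qed.

(** Upwards both products have order -1 and cancel the weight; the remaining rate
    [x x' |y| |p|^m / sigma^4] is the one assumed below 1. Downwards neither product grows and order
    2 remains. *)
Lemma bigeom_G b u v x x' m : bounded b -> (0 < x)%R -> (0 < x')%R ->
  (forall k, (Cnorm (u k) <= x)%R) -> (forall k, (Cnorm (v k) <= x')%R) ->
  (x * x' * Cnorm y * powerRZ (Cnorm p) m < sigma ^ 4)%R ->
  bigeom (fun k r => b k * (P (u k / CpowZ p r) * P (v k / CpowZ p r))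
    * (CpowZ p (m * r) * thetaW r)).
Proof.
intros [B hB] hx hx' hu hv H. unfold thetaW. assert (h := Cnorm_gt0 q hq0).
split.
- eapply (gbound_geom q); cycle 2; [gbound_tac|reflexivity|].
  rewrite !Z.mul_1_r. simpl (powerRZ _ 1). simpl (powerRZ _ (-2)). rewrite !Rmult_1_l, !Rmult_1_r.
  apply Rmult_lt_reg_r with (sigma ^ 4)%R; [now apply pow_lt|]. rewrite Rmult_1_l.
  eapply Rle_lt_trans; [|exact H]. apply Req_le. field. lra.
- eapply (gbound_gauss_geom q hq0 hq); [|gbound_tac]; apply Z.leb_le; reflexivity.
Qed.

Definition Fterm c d r :=
  P (d * y * CpowZ p r) * P (c * p / CpowZ p r) * thetaW r.
(** The divided difference in [c] taken term by term, after splitting the leading factor off each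
    product that contains [c]. [GtermU] and [RtermU] arise in the same way. *)
Definition FtermU c d r :=
  - (p / CpowZ p r) * (P (d * y * CpowZ p r) * P (c * p * p / CpowZ p r) * thetaW r).

Definition Gterm c d r :=
  P (y * c * d) * (P (c * p / CpowZ p r) * P (d * p / CpowZ p r)) * thetaW r.
Definition GtermU c d r :=
  P (y * c * d * p) * (P (c * p * p / CpowZ p r) * P (d * p / CpowZ p r)) * thetaW r
  * (y * c * d * (p / CpowZ p r) - y * d - p / CpowZ p r).
(** A telescoping certificate: term by term, the relations in [d] hold only up to a multiple of
    [GtermS r - GtermS (r+1)], and this defect sums to 0. [RtermS] does the same for R. *)
Definition GtermS c d r :=
  P (y * c * d * p) * (P (c * p * p / CpowZ p r) * P (d * p * p / CpowZ p r)) * thetaW r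
  * (p / CpowZ p r * (p / CpowZ p r)).

Definition Rterm c d r :=
  (1 - y * CpowZ p r * CpowZ p r / p) * (P (d * y * CpowZ p r) * P (c * y * CpowZ p r)
    * P (c * p / CpowZ p r) * P (d * p / CpowZ p r)) * thetaV r.
Definition RtermU c d r :=
  (1 - y * CpowZ p r * CpowZ p r / p) * (P (d * y * CpowZ p r) * P (c * y * p * CpowZ p r)
    * P (c * p * p / CpowZ p r) * P (d * p / CpowZ p r)) * thetaV r
  * (c * y * p - y * CpowZ p r - p / CpowZ p r).
Definition RtermS c d r :=
  P (d * y * CpowZ p r) * P (c * y * CpowZ p r)
    * P (c * p * p / CpowZ p r) * P (d * p * p / CpowZ p r) * thetaV r
  * (p / CpowZ p r * (p / CpowZ p r)).

(** * Termwise contiguous relations *)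

Lemma qpinf_step u v : u * p = v -> P u = (1 - u) * P v.
Proof. intros <-. now apply qpinf_rec. Qed.

(** With [p^r] generalised to a nonzero [w], and all products brought by [qpinf_step] to common
    ones, each relation becomes an identity of rational functions for [field]. *)
Ltac open_terms r :=
  let w := fresh "w" in let hw := fresh "hw" in
  rewrite ?thetaW_succ, ?thetaV_succ, ?(CpowZ_succ p r hp0);
  assert (hw := CpowZ_neq0 p r hp0); set (w := CpowZ p r) in *; clearbody w.

Lemma Fterm_c c d r : Fterm c d r - Fterm (c * p) d r = c * FtermU c d r.
Proof.
unfold Fterm, FtermU. open_terms r.
rewrite (qpinf_step (c * p / w) (c * p * p / w)) by (field; auto).
field; auto.
Qed.

(** For F the two divided differences agree up to a shift of the index, so [FtermU] serves as its
    own telescoping certificate. *)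
Lemma Fterm_d c d r : Fterm c d r - Fterm c (d * p) r = d * FtermU c d (r + 1).
Proof.
unfold Fterm, FtermU. open_terms r.
rewrite (qpinf_step (d * y * w) (d * y * (w * p))) by (field; auto).
replace (d * p * y * w) with (d * y * (w * p)) by ring.
replace (c * p * p / (w * p)) with (c * p / w) by (field; auto).
field; auto.
Qed.

Lemma FtermU_d c d r : FtermU c d r - FtermU c (d * p) r = y * p * d * Fterm (c * p) (d * p) r.
Proof.
unfold Fterm, FtermU. open_terms r.
rewrite (qpinf_step (d * y * w) (d * p * y * w)) by (field; auto).
field; auto.
Qed.

Lemma Gterm_c c d r : Gterm c d r - Gterm (c * p) d r = c * GtermU c d r.
Proof.
unfold Gterm, GtermU. open_terms r.
rewrite (qpinf_step (c * p / w) (c * p * p / w)) by (field; auto).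
rewrite (qpinf_step (y * c * d) (y * c * d * p)) by ring.
replace (y * (c * p) * d) with (y * c * d * p) by ring.
field; auto.
Qed.

Lemma Gterm_d c d r : Gterm c d r - Gterm c (d * p) r - d * GtermU c d r
  = d * (c - d) * (GtermS c d r - GtermS c d (r + 1)).
Proof.
unfold Gterm, GtermU, GtermS. open_terms r.
rewrite (qpinf_step (c * p / w) (c * p * p / w)) by (field; auto).
rewrite (qpinf_step (d * p / w) (d * p * p / w)) by (field; auto).
rewrite (qpinf_step (y * c * d) (y * c * d * p)) by ring.
replace (y * c * (d * p)) with (y * c * d * p) by ring.
replace (c * p * p / (w * p)) with (c * p / w) by (field; auto).
replace (d * p * p / (w * p)) with (d * p / w) by (field; auto).
rewrite (qpinf_step (c * p / w) (c * p * p / w)) by (field; auto).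
rewrite (qpinf_step (d * p / w) (d * p * p / w)) by (field; auto).
field; auto.
Qed.

Lemma GtermU_d c d r : GtermU c d r - GtermU c (d * p) r - y * p * d * Gterm (c * p) (d * p) r
  = d * (GtermS c d r - GtermS c d (r + 1)).
Proof.
unfold Gterm, GtermU, GtermS. open_terms r.
rewrite (qpinf_step (d * p / w) (d * p * p / w)) by (field; auto).
rewrite (qpinf_step (y * c * d * p) (y * c * d * p * p)) by ring.
replace (y * c * (d * p) * p) with (y * c * d * p * p) by ring.
replace (y * (c * p) * (d * p)) with (y * c * d * p * p) by ring.
replace (c * p * p / (w * p)) with (c * p / w) by (field; auto).
replace (d * p * p / (w * p)) with (d * p / w) by (field; auto).
rewrite (qpinf_step (c * p / w) (c * p * p / w)) by (field; auto).
rewrite (qpinf_step (d * p / w) (d * p * p / w)) by (field; auto).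
field; auto.
Qed.

Lemma Rterm_c c d r : Rterm c d r - Rterm (c * p) d r = c * RtermU c d r.
Proof.
unfold Rterm, RtermU. open_terms r.
rewrite (qpinf_step (c * p / w) (c * p * p / w)) by (field; auto).
rewrite (qpinf_step (c * y * w) (c * y * p * w)) by ring.
replace (c * p * y * w) with (c * y * p * w) by ring.
field; auto.
Qed.

Lemma Rterm_d c d r : Rterm c d r - Rterm c (d * p) r - d * RtermU c d r
  = d * (c - d) * (RtermS c d r - RtermS c d (r + 1)).
Proof.
unfold Rterm, RtermU, RtermS. open_terms r.
replace (d * p * y * w) with (d * y * (w * p)) by ring.
replace (c * y * p * w) with (c * y * (w * p)) by ring.
replace (c * p * p / (w * p)) with (c * p / w) by (field; auto).
replace (d * p * p / (w * p)) with (d * p / w) by (field; auto).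
rewrite (qpinf_step (c * p / w) (c * p * p / w)) by (field; auto).
rewrite (qpinf_step (d * p / w) (d * p * p / w)) by (field; auto).
rewrite (qpinf_step (c * y * w) (c * y * (w * p))) by ring.
rewrite (qpinf_step (d * y * w) (d * y * (w * p))) by ring.
field; auto.
Qed.

Lemma RtermU_d c d r : RtermU c d r - RtermU c (d * p) r - y * p * d * Rterm (c * p) (d * p) r
  = d * (RtermS c d r - RtermS c d (r + 1)).
Proof.
unfold Rterm, RtermU, RtermS. open_terms r.
replace (d * p * y * w) with (d * y * (w * p)) by ring.
replace (c * p * y * w) with (c * y * (w * p)) by ring.
replace (c * y * p * w) with (c * y * (w * p)) by ring.
replace (c * p * p / (w * p)) with (c * p / w) by (field; auto).
replace (d * p * p / (w * p)) with (d * p / w) by (field; auto).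
rewrite (qpinf_step (c * p / w) (c * p * p / w)) by (field; auto).
rewrite (qpinf_step (d * p / w) (d * p * p / w)) by (field; auto).
rewrite (qpinf_step (c * y * w) (c * y * (w * p))) by ring.
rewrite (qpinf_step (d * y * w) (d * y * (w * p))) by ring.
field; auto.
Qed.

(** * Summability of the terms, uniformly over the lattice *)

Lemma bigeom_Fterm c d : bounded c -> bounded d -> bigeom (fun k r => Fterm (c k) (d k) r).
Proof.
intros hc hd. eapply bigeom_ext; [|apply bigeom_F with
  (b := fun _ => 1) (u := fun k => d k * y) (v := fun k => c k * p) (m := 0%Z)];
  auto using bounded_const, bounded_mul.
intros k r. unfold Fterm. simpl (CpowZ p (0 * r)). ring.
Qed.

Lemma bigeom_FtermU c d : bounded c -> bounded d -> bigeom (fun k r => FtermU (c k) (d k) r).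
Proof.
intros hc hd. eapply bigeom_ext; [|apply bigeom_F with
  (b := fun _ => - p) (u := fun k => d k * y) (v := fun k => c k * p * p) (m := (-1)%Z)];
  auto using bounded_const, bounded_mul.
intros k r. unfold FtermU. rewrite CpowZ_minus1. open_terms r. field; auto.
Qed.

Lemma bounded_le u x : (forall k, (Cnorm (u k) <= x)%R) -> bounded u.
Proof. now exists x. Qed.

Lemma bounded_qpinf u : bounded u -> bounded (fun k => P (u k)).
Proof. intros [M hM]. exists (qpbound p M). intros k. now apply qpinf_norm_le. Qed.

Section GeomG.

Context (c d : nat -> Cplx) (x x' : R) (hx : (0 < x)%R) (hx' : (0 < x')%R)
  (hc : forall k, (Cnorm (c k) <= x)%R) (hd : forall k, (Cnorm (d k) <= x')%R)
  (hxx : (x * x' * Cnorm y < 1)%R).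

Let bc : bounded c := bounded_le c x hc.
Let bd : bounded d := bounded_le d x' hd.

(** Each additional [p] in the argument of a product lowers the rate by [|p|], and this pays for
    negative powers of [p^r]. The rate is at most [x x' |y|] as soon as i + j + m >= 0, with
    equality to 0 for the certificate and for the worst part of [GtermU]. *)
Lemma bigeom_G' b i j m : bounded b -> (2 * Z.of_nat i + 2 * Z.of_nat j + 2 * m >= 0)%Z ->
  bigeom (fun k r => b k * (P (c k * p * Cpow p i / CpowZ p r) * P (d k * p * Cpow p j / CpowZ p r))
    * (CpowZ p (m * r) * thetaW r)).
Proof.
intros hb hm. assert (h := Cnorm_gt0 q hq0). assert (hpn := Cnorm_gt0 p hp0).
set (g := fun (x : R) (i : nat) => (x * Cnorm p * Cnorm p ^ i)%R).
assert (hg0 : forall x i, (0 < x)%R -> (0 < g x i)%R)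
  by (intros; unfold g; repeat apply Rmult_lt_0_compat; auto; now apply pow_lt).
assert (hg : forall z x i, (Cnorm z <= x)%R -> (Cnorm (z * p * Cpow p i) <= g x i)%R).
{ intros z t l ht. rewrite !(Cnorm_mul _ (Cpow p l)), Cnorm_pow, (Cnorm_mul z). unfold g.
  apply Rmult_le_compat_r; [apply pow_le, Cnorm_ge0|]. apply Rmult_le_compat_r; auto; apply Cnorm_ge0. }
apply bigeom_G with (g x i) (g x' j); auto.
unfold g. rewrite !pow_powerRZ.
replace (x * Cnorm p * powerRZ (Cnorm p) (Z.of_nat i) * (x' * Cnorm p * powerRZ (Cnorm p) (Z.of_nat j))
   * Cnorm y * powerRZ (Cnorm p) m)%R
  with (x * x' * Cnorm y * (Cnorm p * Cnorm p) *
    (powerRZ (Cnorm p) (Z.of_nat i) * powerRZ (Cnorm p) (Z.of_nat j) * powerRZ (Cnorm p) m))%R by ring.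
rewrite <- !powerRZ_add by lra.
replace (Z.of_nat i + Z.of_nat j + m)%Z with (Z.of_nat (Z.to_nat (Z.of_nat i + Z.of_nat j + m))) by lia.
rewrite <- !pow_powerRZ.
set (l := Z.to_nat (Z.of_nat i + Z.of_nat j + m)).
assert (hl : (Cnorm p ^ l <= 1)%R) by (rewrite <- (pow1 l); apply pow_incr; lra).
assert (hl0 := pow_lt (Cnorm p) l hpn).
replace (Cnorm p * Cnorm p)%R with (sigma ^ 4)%R by (rewrite Cnorm_mul; ring).
assert (h4 := pow_lt sigma 4 h).
apply Rle_lt_trans with (x * x' * Cnorm y * sigma ^ 4)%R.
- rewrite <- (Rmult_1_r (x * x' * Cnorm y * sigma ^ 4)) at 2.
  apply Rmult_le_compat_l; auto. repeat apply Rmult_le_pos; try lra; try apply Cnorm_ge0.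
- rewrite <- (Rmult_1_l (sigma ^ 4)) at 2. apply Rmult_lt_compat_r; auto.
Qed.

Lemma bigeom_Gterm : bigeom (fun k r => Gterm (c k) (d k) r).
Proof.
eapply bigeom_ext; [|apply bigeom_G' with (b := fun k => P (y * c k * d k)) (i := O) (j := O) (m := 0%Z)];
  auto using bounded_const, bounded_mul, bounded_qpinf; [|lia].
intros k r. unfold Gterm. simpl Cpow. simpl (CpowZ p (0 * r)).
replace (c k * p * 1) with (c k * p) by ring. replace (d k * p * 1) with (d k * p) by ring. ring.
Qed.

Lemma bigeom_GtermU : bigeom (fun k r => GtermU (c k) (d k) r).
Proof.
eapply bigeom_ext; [|apply bigeom_add; [
  apply bigeom_G' with (b := fun k => P (y * c k * d k * p) * - (y * d k)) (i := 1%nat) (j := O) (m := 0%Z)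
 |apply bigeom_G' with (b := fun k => P (y * c k * d k * p) * (y * c k * d k * p + - p)) (i := 1%nat) (j := O) (m := (-1)%Z)]];
  auto 10 using bounded_const, bounded_mul, bounded_qpinf, bounded_opp; try lia.
- intros k r. unfold GtermU. simpl Cpow. simpl (CpowZ p (0 * r)). rewrite CpowZ_minus1.
  replace (c k * p * (1 * p)) with (c k * p * p) by ring.
  replace (d k * p * 1) with (d k * p) by ring. open_terms r. field; auto.
- apply bounded_mul; [auto 10 using bounded_const, bounded_mul, bounded_qpinf|].
  destruct (bounded_mul (fun k => y * c k * d k) (fun _ => p)) as [M hM];
    auto using bounded_const, bounded_mul.
  exists (M + Cnorm (- p))%R; intros k. eapply Rle_trans; [apply Cnorm_add|].
  now apply Rplus_le_compat_r.
Qed.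

Lemma bigeom_GtermS : bigeom (fun k r => GtermS (c k) (d k) r).
Proof.
eapply bigeom_ext; [|apply bigeom_G' with (b := fun k => P (y * c k * d k * p) * (p * p)) (i := 1%nat) (j := 1%nat) (m := (-2)%Z)];
  auto 10 using bounded_const, bounded_mul, bounded_qpinf; [|lia].
intros k r. unfold GtermS. simpl Cpow.
replace (-2 * r)%Z with (-1 * r + -1 * r)%Z by ring. rewrite CpowZ_add, CpowZ_minus1 by auto.
replace (c k * p * (1 * p)) with (c k * p * p) by ring.
replace (d k * p * (1 * p)) with (d k * p * p) by ring. open_terms r. field; auto.
Qed.

End GeomG.

Lemma bigeom_Rterm c d : bounded c -> bounded d -> bigeom (fun k r => Rterm (c k) (d k) r).
Proof.
intros hc hd.
eapply bigeom_ext; [|apply bigeom_add; [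
  apply bigeom_R with (b := fun _ => 1) (u := fun k => d k * y) (u' := fun k => c k * y)
    (v := fun k => c k * p) (v' := fun k => d k * p) (m := 0%Z)
 |apply bigeom_R with (b := fun _ => - (y / p)) (u := fun k => d k * y) (u' := fun k => c k * y)
    (v := fun k => c k * p) (v' := fun k => d k * p) (m := 2%Z)]];
  auto using bounded_const, bounded_mul.
intros k r. unfold Rterm. replace (2 * r)%Z with (r + r)%Z by ring.
rewrite CpowZ_add by auto. simpl (CpowZ p (0 * r)). open_terms r. field; auto.
Qed.

(* (1 - y w^2/p) (c y p - y w - p/w) expanded in powers of w. *)
Lemma bigeom_RtermU c d : bounded c -> bounded d -> bigeom (fun k r => RtermU (c k) (d k) r).
Proof.
intros hc hd.
assert (H : forall b m, bounded b -> bigeom (fun k r =>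
  b k * (P (d k * y * CpowZ p r) * P (c k * y * p * CpowZ p r)
    * P (c k * p * p / CpowZ p r) * P (d k * p / CpowZ p r)) * (CpowZ p (m * r) * thetaV r))).
{ intros b m hb. apply bigeom_R with (u := fun k => d k * y) (u' := fun k => c k * y * p)
    (v := fun k => c k * p * p) (v' := fun k => d k * p); auto using bounded_const, bounded_mul. }
eapply bigeom_ext; [|
  exact (bigeom_add _ _ (H (fun k => c k * y * p) 0%Z ltac:(auto using bounded_const, bounded_mul))
  (bigeom_add _ _ (H (fun k => - y + y) 1%Z (bounded_const _))
  (bigeom_add _ _ (H (fun k => - p) (-1)%Z (bounded_const _))
  (bigeom_add _ _ (H (fun k => c k * (- (y * y))) 2%Z ltac:(auto using bounded_const, bounded_mul))
    (H (fun k => y * y / p) 3%Z (bounded_const _))))))].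
intros k r. unfold RtermU. replace (2 * r)%Z with (r + r)%Z by ring.
replace (3 * r)%Z with (r + r + r)%Z by ring. replace (1 * r)%Z with r by ring.
rewrite CpowZ_minus1. rewrite !CpowZ_add by auto. simpl (CpowZ p (0 * r)). open_terms r. field; auto.
Qed.

Lemma bigeom_RtermS c d : bounded c -> bounded d -> bigeom (fun k r => RtermS (c k) (d k) r).
Proof.
intros hc hd.
eapply bigeom_ext; [|apply bigeom_R with (b := fun _ => p * p)
    (u := fun k => d k * y) (u' := fun k => c k * y)
    (v := fun k => c k * p * p) (v' := fun k => d k * p * p) (m := (-2)%Z)];
  auto using bounded_const, bounded_mul.
intros k r. unfold RtermS.
replace (-2 * r)%Z with (-1 * r + -1 * r)%Z by ring. rewrite CpowZ_add, CpowZ_minus1 by auto.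
open_terms r. field; auto.
Qed.

End Families.

(** * Identities between the sums *)

Section Sums.

Context (q y : Cplx) (hq0 : q <> 0) (hq : (Cnorm q < 1)%R) (hy : y <> 0).

Local Notation p := (q * q).
Local Notation P x := (qpinf x p).

Let hp : (Cnorm p < 1)%R := Cnorm_sqr_lt1 q hq.
Let hp0 : p <> 0 := sqr_neq0 q hq0.

Definition lattice_sum (t : Cplx -> Cplx -> Z -> Cplx) (c d : Cplx) (i j : nat) : Cplx :=
  bisum (t (c * Cpow p i) (d * Cpow p j)).

(** Summation over [r] removes the telescoping defects, whose coefficients [k] and [k'] may depend
    on [c] and [d] but not on [r]. *)
Lemma contiguous_of_terms (t u s : Cplx -> Cplx -> Z -> Cplx) (k k' : Cplx -> Cplx -> Cplx) c d :
  (forall i j, let c := c * Cpow p i in let d := d * Cpow p j in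
     bicv (t c d) (bisum (t c d)) /\ bicv (u c d) (bisum (u c d)) /\ bicv (s c d) (bisum (s c d))) ->
  (forall c d r, t c d r - t (c * p) d r = c * u c d r) ->
  (forall c d r, t c d r - t c (d * p) r - d * u c d r = k c d * (s c d r - s c d (r + 1)%Z)) ->
  (forall c d r, u c d r - u c (d * p) r - y * p * d * t (c * p) (d * p) r
     = k' c d * (s c d r - s c d (r + 1)%Z)) ->
  contiguous p y c d (lattice_sum t c d) (lattice_sum u c d).
Proof.
intros hs h1 h2 h3. unfold lattice_sum.
assert (hS : forall x i, x * Cpow p (S i) = x * Cpow p i * p) by (intros; simpl; ring).
assert (tele : forall k f l, bicv f l -> bicv (fun r => k * (f r - f (r + 1)%Z)) 0).
{ intros k0 f l hf. replace 0 with (k0 * (l - l)) by ring.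
  apply bicv_scal, bicv_sub; auto. now apply bicv_succ. }
repeat split; intros i j; destruct (hs i j) as (t00 & u00 & s00);
  destruct (hs (S i) j) as (t10 & _ & _); destruct (hs i (S j)) as (t01 & u01 & _);
  destruct (hs (S i) (S j)) as (t11 & _ & _);
  rewrite ?hS in *; set (c' := c * Cpow p i) in *; set (d' := d * Cpow p j) in *.
- apply bicv_unique with (fun r => t c' d' r - t (c' * p) d' r); [now apply bicv_sub|].
  apply bicv_ext with (fun r => c' * u c' d' r); [intros; now rewrite h1|now apply bicv_scal].
- apply Csub_eq0, bicv_unique with (fun r => t c' d' r - t c' (d' * p) r - d' * u c' d' r).
  + now repeat first [apply bicv_sub | apply bicv_scal].
  + apply bicv_ext with (1 := fun r => eq_sym (h2 c' d' r)). now apply tele with (bisum (s c' d')).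
- apply Csub_eq0, bicv_unique with
    (fun r => u c' d' r - u c' (d' * p) r - y * p * d' * t (c' * p) (d' * p) r).
  + now repeat first [apply bicv_sub | apply bicv_scal].
  + apply bicv_ext with (1 := fun r => eq_sym (h3 c' d' r)). now apply tele with (bisum (s c' d')).
Qed.

(** [contiguous] is symmetric in [c] and [d] except in its relation for [U], and [contiguous_U_left]
    supplies the mirror image of that one. *)
Lemma contiguous_swap c d X U : c <> 0 -> d <> 0 -> contiguous p y c d X U ->
  contiguous p y d c (fun i j => X j i) (fun i j => U j i).
Proof.
intros hc hd H. assert (h4 := contiguous_U_left p y c d hd hp0 X U H).
destruct H as (h1 & h2 & h3). repeat split; intros; auto.
Qed.

Lemma contiguous_unique c d X U X' U' x u : contiguous p y c d X U -> contiguous p y c d X' U' ->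
  c <> 0 -> d <> 0 ->
  C_cv (fun n => X n n) x -> C_cv (fun n => U n n) u ->
  C_cv (fun n => X' n n) x -> C_cv (fun n => U' n n) u -> X O O = X' O O.
Proof.
intros H H' hc hd hX hU hX' hU'. apply Csub_eq0.
apply (contiguous_zero p y c d hp hd hp0 _ _ (contiguous_sub _ _ _ _ _ _ _ _ H H')).
- replace 0 with (x - x) by ring. now apply C_cv_sub.
- replace 0 with (u - u) by ring. now apply C_cv_sub.
Qed.

(** * The contiguous systems of F, G and R *)

Lemma bicv_Fterm c d : bicv (Fterm q y c d) (bisum (Fterm q y c d)).
Proof.
apply (bigeom_bicv (fun _ => Fterm q y c d) O).
apply (bigeom_Fterm q y hq0 hq hy (fun _ => c) (fun _ => d)); apply bounded_const.
Qed.

Lemma bicv_FtermU c d : bicv (FtermU q y c d) (bisum (FtermU q y c d)).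
Proof.
apply (bigeom_bicv (fun _ => FtermU q y c d) O).
apply (bigeom_FtermU q y hq0 hq hy (fun _ => c) (fun _ => d)); apply bounded_const.
Qed.

Lemma contiguous_F c d :
  contiguous p y c d (lattice_sum (Fterm q y) c d) (lattice_sum (FtermU q y) c d).
Proof.
apply contiguous_of_terms with (s := FtermU q y) (k := fun _ d => - d) (k' := fun _ _ => 0);
  auto using bicv_Fterm, bicv_FtermU; intros c' d' r.
- now apply Fterm_c.
- rewrite Fterm_d by auto. ring.
- rewrite FtermU_d by auto. ring.
Qed.

Lemma Cnorm_mul_pow_le c n : (Cnorm (c * Cpow p n) <= Cnorm c)%R.
Proof.
rewrite Cnorm_mul. generalize (Cnorm_pow_le1 q hq n) (Cnorm_ge0 c) (Cnorm_ge0 (Cpow p n)); nra.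
Qed.

Lemma contiguous_G c d : c <> 0 -> d <> 0 -> (Cnorm (y * c * d) < 1)%R ->
  contiguous p y c d (lattice_sum (Gterm q y) c d) (lattice_sum (GtermU q y) c d).
Proof.
intros hc hd hcd.
assert (hcd' : (Cnorm c * Cnorm d * Cnorm y < 1)%R) by (rewrite !Cnorm_mul in hcd; lra).
apply contiguous_of_terms with (s := GtermS q y) (k := fun c d => d * (c - d)) (k' := fun _ d => d).
- intros i j c' d'.
  assert (hc' := fun _ : nat => Cnorm_mul_pow_le c i). assert (hd' := fun _ : nat => Cnorm_mul_pow_le d j).
  assert (hc0 := Cnorm_gt0 c hc). assert (hd0 := Cnorm_gt0 d hd).
  split; [|split].
  + apply (bigeom_bicv (fun _ => Gterm q y c' d') O).
    now apply (bigeom_Gterm q y hq0 hq hy (fun _ => c') (fun _ => d') (Cnorm c) (Cnorm d)).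
  + apply (bigeom_bicv (fun _ => GtermU q y c' d') O).
    now apply (bigeom_GtermU q y hq0 hq hy (fun _ => c') (fun _ => d') (Cnorm c) (Cnorm d)).
  + apply (bigeom_bicv (fun _ => GtermS q y c' d') O).
    now apply (bigeom_GtermS q y hq0 hq hy (fun _ => c') (fun _ => d') (Cnorm c) (Cnorm d)).
- intros; now apply Gterm_c.
- intros; now apply Gterm_d.
- intros; now apply GtermU_d.
Qed.

Lemma bicv_Rterm c d : bicv (Rterm q y c d) (bisum (Rterm q y c d)).
Proof.
apply (bigeom_bicv (fun _ => Rterm q y c d) O).
apply (bigeom_Rterm q y hq0 hq hy (fun _ => c) (fun _ => d)); apply bounded_const.
Qed.

Lemma bicv_RtermU c d : bicv (RtermU q y c d) (bisum (RtermU q y c d)).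
Proof.
apply (bigeom_bicv (fun _ => RtermU q y c d) O).
apply (bigeom_RtermU q y hq0 hq hy (fun _ => c) (fun _ => d)); apply bounded_const.
Qed.

Lemma bicv_RtermS c d : bicv (RtermS q y c d) (bisum (RtermS q y c d)).
Proof.
apply (bigeom_bicv (fun _ => RtermS q y c d) O).
apply (bigeom_RtermS q y hq0 hq hy (fun _ => c) (fun _ => d)); apply bounded_const.
Qed.

Lemma contiguous_R c d :
  contiguous p y c d (lattice_sum (Rterm q y) c d) (lattice_sum (RtermU q y) c d).
Proof.
apply contiguous_of_terms with (s := RtermS q y) (k := fun c d => d * (c - d)) (k' := fun _ d => d);
  auto using bicv_Rterm, bicv_RtermU, bicv_RtermS; intros c' d' r.
- now apply Rterm_c.
- now apply Rterm_d.
- now apply RtermU_d.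
Qed.

(** * Limits along the diagonal *)

Ltac small_tac := unfold Cdiv;
  repeat first [ apply small_pow | apply small_const_r | apply small_const_l | apply small_mul ];
  auto.

Ltac cv_tac := intros r;
  repeat first [ apply C_cv_const
               | apply qpinf_cv1; [assumption|small_tac; fail]
               | apply small_cv with p; [assumption|small_tac; fail]
               | apply C_cv_mul | apply C_cv_sub | apply C_cv_add | apply C_cv_opp ].

Lemma bounded_mul_pow c : bounded (fun n => c * Cpow p n).
Proof. exists (Cnorm c). apply Cnorm_mul_pow_le. Qed.

Lemma lattice_F_cv c d :
  C_cv (fun n => lattice_sum (Fterm q y) c d n n) (bisum (thetaW q y)).
Proof.
destruct (bigeom_Fterm q y hq0 hq hy _ _ (bounded_mul_pow c) (bounded_mul_pow d)) as [h1 h2].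
apply (bisum_tannery _ _ h1 h2). unfold Fterm. intros r.
(* Every product tends to 1; keeping these ones visible lets [cv_tac] match the limit with the shape
   of the term. *)
replace (thetaW q y r) with (1 * 1 * thetaW q y r) at 1 by ring. revert r. cv_tac.
Qed.

Lemma lattice_FU_cv c d :
  C_cv (fun n => lattice_sum (FtermU q y) c d n n)
    (bisum (fun r => - (p / CpowZ p r) * thetaW q y r)).
Proof.
destruct (bigeom_FtermU q y hq0 hq hy _ _ (bounded_mul_pow c) (bounded_mul_pow d)) as [h1 h2].
apply (bisum_tannery _ _ h1 h2). unfold FtermU. intros r.
replace (- (p / CpowZ p r) * thetaW q y r)
  with (- (p / CpowZ p r) * (1 * 1 * thetaW q y r)) by ring. revert r. cv_tac.
Qed.

Lemma lattice_G_cv c d : c <> 0 -> d <> 0 -> (Cnorm (y * c * d) < 1)%R ->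
  C_cv (fun n => lattice_sum (Gterm q y) c d n n) (bisum (thetaW q y)).
Proof.
intros hc hd hcd.
assert (hcd' : (Cnorm c * Cnorm d * Cnorm y < 1)%R) by (rewrite !Cnorm_mul in hcd; lra).
destruct (bigeom_Gterm q y hq0 hq hy _ _ _ _ (Cnorm_gt0 c hc) (Cnorm_gt0 d hd)
  (Cnorm_mul_pow_le c) (Cnorm_mul_pow_le d) hcd') as [h1 h2].
apply (bisum_tannery _ _ h1 h2). unfold Gterm. intros r.
replace (thetaW q y r) with (1 * (1 * 1) * thetaW q y r) at 1 by ring. revert r. cv_tac.
Qed.

Lemma lattice_GU_cv c d : c <> 0 -> d <> 0 -> (Cnorm (y * c * d) < 1)%R ->
  C_cv (fun n => lattice_sum (GtermU q y) c d n n)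
    (bisum (fun r => - (p / CpowZ p r) * thetaW q y r)).
Proof.
intros hc hd hcd.
assert (hcd' : (Cnorm c * Cnorm d * Cnorm y < 1)%R) by (rewrite !Cnorm_mul in hcd; lra).
destruct (bigeom_GtermU q y hq0 hq hy _ _ _ _ (Cnorm_gt0 c hc) (Cnorm_gt0 d hd)
  (Cnorm_mul_pow_le c) (Cnorm_mul_pow_le d) hcd') as [h1 h2].
apply (bisum_tannery _ _ h1 h2). unfold GtermU. intros r.
replace (- (p / CpowZ p r) * thetaW q y r)
  with (1 * (1 * 1) * thetaW q y r * (0 * (p / CpowZ p r) - 0 - p / CpowZ p r)) by ring.
revert r. cv_tac.
Qed.

(** The order of quantifiers matters: the limit is fixed before [c] and [d], so what is learnt about
    it at c = 1, d = p/y holds everywhere. *)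
Lemma lattice_R_cv : exists x, forall c d, C_cv (fun n => lattice_sum (Rterm q y) c d n n) x.
Proof.
exists (bisum (fun r => (1 - y * CpowZ p r * CpowZ p r / p) * (1 * 1 * 1 * 1) * thetaV q y r)).
intros c d.
destruct (bigeom_Rterm q y hq0 hq hy _ _ (bounded_mul_pow c) (bounded_mul_pow d)) as [h1 h2].
apply (bisum_tannery _ _ h1 h2). unfold Rterm. cv_tac.
Qed.

Lemma lattice_RU_cv : exists u, forall c d, C_cv (fun n => lattice_sum (RtermU q y) c d n n) u.
Proof.
exists (bisum (fun r => (1 - y * CpowZ p r * CpowZ p r / p) * (1 * 1 * 1 * 1) * thetaV q y r
  * (0 - y * CpowZ p r - p / CpowZ p r))).
intros c d.
destruct (bigeom_RtermU q y hq0 hq hy _ _ (bounded_mul_pow c) (bounded_mul_pow d)) as [h1 h2].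
apply (bisum_tannery _ _ h1 h2). unfold RtermU. cv_tac.
Qed.

Lemma lattice_sum_O t c d : lattice_sum t c d O O = bisum (t c d).
Proof.
unfold lattice_sum; simpl. now replace (c * 1) with c by ring; replace (d * 1) with d by ring.
Qed.

Lemma bisum_F_sym c d : c <> 0 -> d <> 0 -> bisum (Fterm q y c d) = bisum (Fterm q y d c).
Proof.
intros hc hd. rewrite <- !lattice_sum_O.
apply (contiguous_unique c d _ _ (fun i j => lattice_sum (Fterm q y) d c j i) _ _ _
  (contiguous_F c d) (contiguous_swap d c _ _ hd hc (contiguous_F d c)) hc hd
  (lattice_F_cv c d) (lattice_FU_cv c d) (lattice_F_cv d c) (lattice_FU_cv d c)).
Qed.

Lemma bisum_F_G c d : c <> 0 -> d <> 0 -> (Cnorm (y * c * d) < 1)%R ->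
  bisum (Fterm q y c d) = bisum (Gterm q y c d).
Proof.
intros hc hd h. rewrite <- !lattice_sum_O.
apply (contiguous_unique c d _ _ _ _ _ _ (contiguous_F c d) (contiguous_G c d hc hd h) hc hd
  (lattice_F_cv c d) (lattice_FU_cv c d) (lattice_G_cv c d hc hd h) (lattice_GU_cv c d hc hd h)).
Qed.

(** * The terminating sums at c = 1, d = p/y *)

Lemma qpinf_mul_powZ_eq0 r : (r < 0)%Z -> P (p * CpowZ p r) = 0.
Proof.
intros h. apply (qpinf_eq0 p hp _ (Z.to_nat (- r - 1))).
rewrite <- CpowZ_nat. replace (p * CpowZ p r) with (CpowZ p (r + 1)) by (rewrite CpowZ_succ by auto; ring).
rewrite <- CpowZ_add by auto. now replace (r + 1 + Z.of_nat (Z.to_nat (- r - 1)))%Z with 0%Z by lia.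
Qed.

Lemma qpinf_div_powZ_eq0 r : (0 < r)%Z -> P (p / CpowZ p r) = 0.
Proof.
intros h. unfold Cdiv. rewrite <- CpowZ_opp by auto. apply qpinf_mul_powZ_eq0. lia.
Qed.

Lemma pow_neq1 n : Cpow p (S n) <> 1.
Proof.
intros h. assert (h' := Cnorm_pow p (S n)). rewrite h, Cnorm1 in h'.
assert (Cnorm p ^ S n < 1)%R by (apply pow_lt_1_compat; [split; [apply Cnorm_ge0|auto]|lia]).
lra.
Qed.

Let theta := - (y / p) * (P y * P (p / y)).

(** [P(p p^r)] kills the terms with r < 0 and [P(p / p^r)] those with r > 0. Comparing the terms at
    r = 0 dictates [theta], since [P(p/y) = (1 - p/y) P(p^2/y)] and [-(y/p)(1 - p/y) = 1 - y/p]. *)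
Lemma base_X : theta * bisum (Fterm q y 1 (p / y)) = bisum (Rterm q y 1 (p / y)).
Proof.
assert (z1 : forall r, p / y * y * CpowZ p r = p * CpowZ p r) by (intros; field; auto).
assert (z2 : forall r, 1 * p / CpowZ p r = p / CpowZ p r)
  by (intros; field; now apply CpowZ_neq0).
rewrite (bisum_two (Fterm q y 1 (p / y))).
2:{ intros r h0 h1. unfold Fterm. rewrite z1, z2.
  destruct (Z_lt_ge_dec r 0); [rewrite qpinf_mul_powZ_eq0 by auto; ring|].
  rewrite qpinf_div_powZ_eq0 by lia; ring. }
rewrite (bisum_two (Rterm q y 1 (p / y))).
2:{ intros r h0 h1. unfold Rterm. rewrite z1, z2.
  destruct (Z_lt_ge_dec r 0); [rewrite qpinf_mul_powZ_eq0 by auto; ring|].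
  rewrite qpinf_div_powZ_eq0 by lia; ring. }
unfold Fterm, Rterm. rewrite !z1, !z2, (qpinf_div_powZ_eq0 1), thetaW_0, thetaV_0 by lia.
simpl (CpowZ p 0). unfold theta.
rewrite (qpinf_step q hq (p / y) (p / y * p / 1)) by (field; auto using Cone_neq0).
replace (p * 1) with p by ring. replace (p / 1) with p by (field; apply Cone_neq0).
replace (1 * y * 1) with y by ring. field. repeat split; auto using Cone_neq0.
Qed.

(** In the divided difference the product with [c] carries one more [p], so it vanishes only from r
    = 2 on; both r = 0 and r = 1 contribute. *)
Lemma base_U : theta * bisum (FtermU q y 1 (p / y)) = bisum (RtermU q y 1 (p / y)).
Proof.
assert (z1 : forall r, p / y * y * CpowZ p r = p * CpowZ p r) by (intros; field; auto).
assert (z2 : forall r, 1 * p * p / CpowZ p r = p / CpowZ p (r - 1)).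
{ intros r. replace (CpowZ p r) with (CpowZ p (r - 1) * p).
  - field; split; [now apply CpowZ_neq0|auto].
  - rewrite <- CpowZ_succ by auto. f_equal. ring. }
assert (van : forall r, r <> 0%Z -> r <> 1%Z -> P (p * CpowZ p r) = 0 \/ P (p / CpowZ p (r - 1)) = 0).
{ intros r h0 h1. destruct (Z_lt_ge_dec r 0); [left; now apply qpinf_mul_powZ_eq0|].
  right; apply qpinf_div_powZ_eq0; lia. }
rewrite (bisum_two (FtermU q y 1 (p / y))).
2:{ intros r h0 h1. unfold FtermU. rewrite z1, z2.
  destruct (van r h0 h1) as [e|e]; rewrite e; ring. }
rewrite (bisum_two (RtermU q y 1 (p / y))).
2:{ intros r h0 h1. unfold RtermU. rewrite z1, z2.
  destruct (van r h0 h1) as [e|e]; rewrite e; ring. }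
unfold FtermU, RtermU.
rewrite ?thetaW_0, ?thetaV_0, thetaW_1, thetaV_1, !CpowZ_1 by auto.
simpl (CpowZ p 0). unfold theta.
replace (p / y * y * 1) with p by (field; auto).
replace (p / y * y * p) with (p * p) by (field; auto).
replace (1 * p * p / 1) with (p * p) by (field; apply Cone_neq0).
replace (1 * p * p / p) with p by (field; auto).
replace (1 * y * p * 1) with (y * p) by ring.
replace (1 * y * p * p) with (y * p * p) by ring.
replace (p / y * p / p) with (p / y) by (field; auto).
rewrite (qpinf_step q hq y (y * p)) by ring.
rewrite (qpinf_step q hq (y * p) (y * p * p)) by ring.
rewrite (qpinf_step q hq (p / y) (p / y * p / 1)) by (field; auto using Cone_neq0).
field. repeat split; auto using Cone_neq0.
Qed.

(* Both sides are fixed by their limits along (c p^n, d p^n), which do not depend on c and d;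
   these limits agree because the two sums terminate at c = 1, d = p/y. *)
Lemma bisum_F_R c d : c <> 0 -> d <> 0 ->
  theta * bisum (Fterm q y c d) = bisum (Rterm q y c d).
Proof.
intros hc hd.
destruct lattice_R_cv as [x hx]. destruct lattice_RU_cv as [u hu].
assert (scaled : forall v l, C_cv v l -> C_cv (fun n => theta * v n) (theta * l))
  by (intros; apply C_cv_mul; auto using C_cv_const).
assert (hpy : p / y <> 0) by (apply Cmul_neq0; auto using Cinv_neq0).
assert (base := contiguous_zero_diag p y 1 (p / y) Cone_neq0 hpy hp0 _ _
  (contiguous_sub _ _ _ _ _ _ _ _
    (contiguous_scal _ _ _ _ theta _ _ (contiguous_F 1 (p / y))) (contiguous_R 1 (p / y)))).
cbv beta in base. rewrite !lattice_sum_O, base_X, base_U in base.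
assert (hn : forall n, y * p * 1 * (p / y) * Cpow p n <> 1).
{ intros n. replace (y * p * 1 * (p / y) * Cpow p n) with (Cpow p (S (S n)))
    by (simpl; field; auto). apply pow_neq1. }
specialize (base hn ltac:(ring) ltac:(ring)).
assert (ex : theta * bisum (thetaW q y) = x).
{ apply C_cv_unique with (2 := hx 1 (p / y)).
  apply C_cv_ext with (2 := scaled _ _ (lattice_F_cv 1 (p / y))).
  intros n. apply Csub_eq0, base. }
assert (eu : theta * bisum (fun r => - (p / CpowZ p r) * thetaW q y r) = u).
{ apply C_cv_unique with (2 := hu 1 (p / y)).
  apply C_cv_ext with (2 := scaled _ _ (lattice_FU_cv 1 (p / y))).
  intros n. apply Csub_eq0, base. }
rewrite <- !lattice_sum_O.
apply (contiguous_unique c d _ _ _ _ x u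
  (contiguous_scal _ _ _ _ theta _ _ (contiguous_F c d)) (contiguous_R c d) hc hd); auto.
- rewrite <- ex. apply scaled, lattice_F_cv.
- rewrite <- eu. apply scaled, lattice_FU_cv.
Qed.

End Sums.

(** * Reduction of the Pochhammer symbols *)

Lemma qpochZ_nat a p n : qpochZ a p (Z.of_nat n) = qpoch a p n.
Proof. destruct n; simpl; [reflexivity|now rewrite SuccNat2Pos.id_succ]. Qed.

Lemma qpochZ_neg a p n :
  qpochZ a p (- Z.of_nat n) = Cinv (qpoch (a * CpowZ p (- Z.of_nat n)) p n).
Proof.
destruct n; [simpl; field; apply Cone_neq0|].
simpl. now rewrite SuccNat2Pos.id_succ.
Qed.

Section Reduction.

Context (q : Cplx) (hq0 : q <> 0) (hq : (Cnorm q < 1)%R).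

Local Notation p := (q * q).
Local Notation P x := (qpinf x p).

Let hp : (Cnorm p < 1)%R := Cnorm_sqr_lt1 q hq.
Let hp0 : p <> 0 := sqr_neq0 q hq0.

(** Since [Cinv 0 = 0], a vanishing denominator at a negative index makes [qpochZ] itself 0, which
    [poch_neg_ok] excludes. *)
Lemma poch_neg_qpoch_neq0 a n : poch_neg_ok a p ->
  qpoch (a * CpowZ p (- Z.of_nat (S n))) p (S n) <> 0.
Proof.
intros ha h. apply (ha (- Z.of_nat (S n))%Z); [lia|]. rewrite qpochZ_neg, h. apply Cinv0.
Qed.

Lemma poch_neg_factor a n : poch_neg_ok a p -> 1 - a * CpowZ p (- Z.of_nat (S n)) <> 0.
Proof.
intros ha h. apply (poch_neg_qpoch_neq0 a n ha). rewrite qpoch_head, h. ring.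
Qed.

Lemma CpowZ_opp_succ n : CpowZ p (- Z.of_nat (S n)) * p = CpowZ p (- Z.of_nat n).
Proof. rewrite <- CpowZ_succ by auto. f_equal. lia. Qed.

Lemma qpochZ_succ a r : poch_neg_ok a p ->
  qpochZ a p (r + 1) = qpochZ a p r * (1 - a * CpowZ p r).
Proof.
intros ha. destruct (Z_nat_cases r) as [n [->| ->]].
- replace (Z.of_nat n + 1)%Z with (Z.of_nat (S n)) by lia.
  now rewrite !qpochZ_nat, CpowZ_nat.
- replace (- Z.of_nat (S n) + 1)%Z with (- Z.of_nat n)%Z by lia.
  rewrite !qpochZ_neg. assert (h := poch_neg_qpoch_neq0 a n ha).
  assert (h1 := poch_neg_factor a n ha). rewrite qpoch_head in *.
  replace (a * CpowZ p (- Z.of_nat (S n)) * p) with (a * CpowZ p (- Z.of_nat n)) in *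
    by (rewrite <- CpowZ_opp_succ; ring).
  set (u := a * CpowZ p (- Z.of_nat (S n))) in *.
  set (v := qpoch _ p n) in *. field. split; auto.
  intros e; apply h; rewrite e; ring.
Qed.

Lemma qpinf_qpochZ b r : poch_neg_ok b p -> P b = qpochZ b p r * P (b * CpowZ p r).
Proof.
intros hb.
assert (step : forall s, qpochZ b p (s + 1) * P (b * CpowZ p (s + 1))
  = qpochZ b p s * P (b * CpowZ p s)).
{ intros s. rewrite qpochZ_succ, CpowZ_succ by auto.
  rewrite (qpinf_step q hq (b * CpowZ p s) (b * (CpowZ p s * p))) by ring. ring. }
revert r. apply Z_bi_ind.
- simpl. replace (b * 1) with b by ring. ring.
- intros r ->. symmetry. apply step.
- intros r ->. apply step.
Qed.

(** Reversal of factors: [1 - a p^j = - a p^j (1 - p^(-j) / a)], and the [- a p^j] multiply to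
    [(-a)^r p^(r(r-1)/2)], where the half exponent is an integral power of [q]. This brings
    numerator symbols to the form [P(c p^(1-r))] with c = 1/a. *)
Lemma qpochZ_qpinf_reflect a r : a <> 0 -> poch_neg_ok a p ->
  qpochZ a p r * P (p / a) = P (p / a / CpowZ p r) * (CpowZ (- a) r * CpowZ q (r * r - r)).
Proof.
intros ha0 hneg.
assert (ha1 : - a <> 0).
{ intros h. apply ha0. replace a with (- - a) by ring. rewrite h; ring. }
assert (step : forall s, P (p / a / CpowZ p (s + 1)) * (CpowZ (- a) (s + 1) * CpowZ q ((s + 1) * (s + 1) - (s + 1)))
  = (1 - a * CpowZ p s) * (P (p / a / CpowZ p s) * (CpowZ (- a) s * CpowZ q (s * s - s)))).
{ intros s. replace ((s + 1) * (s + 1) - (s + 1))%Z with (s * s - s + (s + s))%Z by ring.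
  rewrite (CpowZ_add q _ (s + s)), (CpowZ_add q s s), <- CpowZ_mul_base, !CpowZ_succ by auto.
  assert (hw := CpowZ_neq0 p s hp0). set (w := CpowZ p s) in *. clearbody w.
  rewrite (qpinf_step q hq (p / a / (w * p)) (p / a / w)) by (field; auto).
  field; auto. }
destruct (Z_nat_cases r) as [n [->| ->]].
- induction n.
  + simpl. replace (p / a / 1) with (p / a) by (field; auto using Cone_neq0). ring.
  + replace (Z.of_nat (S n)) with (Z.of_nat n + 1)%Z by lia.
    rewrite step, <- IHn, qpochZ_succ by auto. ring.
(* Downwards the recursion has to be divided by [1 - a p^(-m-1)], which is nonzero by
   [poch_neg_factor]. *)
- assert (back : forall m, qpochZ a p (- Z.of_nat m) * P (p / a)
    = P (p / a / CpowZ p (- Z.of_nat m)) * (CpowZ (- a) (- Z.of_nat m)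
       * CpowZ q (- Z.of_nat m * - Z.of_nat m - - Z.of_nat m))); [|apply back].
  induction m.
  + simpl. replace (p / a / 1) with (p / a) by (field; auto using Cone_neq0). ring.
  + apply Cmul_cancel_l with (1 - a * CpowZ p (- Z.of_nat (S m))); [now apply poch_neg_factor|].
    rewrite <- step. replace (- Z.of_nat (S m) + 1)%Z with (- Z.of_nat m)%Z by lia.
    rewrite <- IHm. replace (- Z.of_nat m)%Z with (- Z.of_nat (S m) + 1)%Z by lia.
    rewrite qpochZ_succ by auto. ring.
Qed.

Lemma qpinf_neq0_all_nz b : poch_all_nz b p -> P b <> 0.
Proof.
intros hb. apply (qpinf_neq0 p hp). intros n h. apply (hb (Z.of_nat (S n))).
rewrite qpochZ_nat. simpl. rewrite h. ring.
Qed.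

(** A zero of the product means [a = p^(n+1)], and then [(a;p)_r] has a vanishing denominator at r =
    -(n+1). *)
Lemma qpinf_neq0_neg_ok a : a <> 0 -> poch_neg_ok a p -> P (p / a) <> 0.
Proof.
intros ha0 ha. apply (qpinf_neq0 p hp). intros n h.
apply (poch_neg_factor a n ha). rewrite CpowZ_neg.
replace (Cinv (Cpow p (S n))) with (p / a * Cpow p n * Cinv (Cpow p (S n))) by (rewrite h; ring).
assert (hn := Cpow_neq0 p n hp0). simpl. field. auto.
Qed.

Lemma poch_all_nz_neg_ok b : poch_all_nz b p -> poch_neg_ok b p.
Proof. intros h r _; apply h. Qed.

Lemma bisum_scaled (f g : Z -> Cplx) (k : Cplx) : k <> 0 ->
  bicv g (bisum g) -> (forall r, k * f r = g r) -> k * bisum f = bisum g.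
Proof.
intros hk hg h.
rewrite (bisum_eq f (Cinv k * bisum g)); [field; auto|].
apply bicv_ext with (fun r => Cinv k * g r); [|now apply bicv_scal].
intros r. rewrite <- h. field; auto.
Qed.

End Reduction.

(** * The three identities in the original parameters *)

Theorem mainTheorem14 (q a b z : Cplx) :
  (Cnorm q < 1)%R -> q <> RtoC 0%R ->
  a <> RtoC 0%R -> b <> RtoC 0%R -> z <> RtoC 0%R ->
  let Q := q * q in
  let one := RtoC 1%R in
  let L := bisum (fun r => qpochZ a Q r * CpowZ z r * CpowZ q (r * r)%Z
                           / qpochZ b Q r) in
  (* (i) *)
  (poch_neg_ok a Q -> poch_all_nz b Q ->
   poch_neg_ok (- (a * z * q / b)) Q -> poch_all_nz (- (z * q)) Q ->
   qpinf b Q <> RtoC 0%R -> qpinf (Q / a) Q <> RtoC 0%R ->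
   L = qpinf (- (z * q)) Q * qpinf (- (q * b / (a * z))) Q
         / (qpinf b Q * qpinf (Q / a) Q)
       * bisum (fun r => qpochZ (- (a * z * q / b)) Q r / qpochZ (- (z * q)) Q r
                         * CpowZ (- b) r * CpowZ q (r * r - r)%Z))
  /\
  (* (ii) *)
  ((Cnorm (b / a) < 1)%R ->
   poch_neg_ok a Q -> poch_all_nz b Q ->
   poch_neg_ok (- (a * z * q / b)) Q ->
   qpinf b Q <> RtoC 0%R ->
   L = qpinf (b / a) Q * qpinf (- (q * b / (a * z))) Q / qpinf b Q
       * bisum (fun r => qpochZ (- (a * z * q / b)) Q r * qpochZ a Q r
                         * CpowZ (b / a) r))
  /\
  (* (iii) *)
  (poch_neg_ok a Q -> poch_all_nz b Q ->
   poch_neg_ok (- (a * z * q / b)) Q -> poch_all_nz (- (z * q)) Q ->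
   qpinf (- (q * q * q / (a * z))) Q <> RtoC 0%R ->
   qpinf (- (a * q * z)) Q <> RtoC 0%R ->
   one + a * z / q <> RtoC 0%R ->
   L = qpinf (- (b * q / (a * z))) Q * qpinf (- (q * z)) Q
         / (qpinf (- (q * q * q / (a * z))) Q * qpinf (- (a * q * z)) Q)
       * bisum (fun r =>
           (one + a * z * CpowZ q (4 * r - 1)%Z)
           * qpochZ a Q r * qpochZ (- (a * z * q / b)) Q r
           * CpowZ (b * a * z * z) r * CpowZ q (4 * r * r - 4 * r)%Z
           / ((one + a * z / q) * qpochZ b Q r * qpochZ (- (z * q)) Q r))).
Proof.
intros hq hq0 ha hb hz Q one L.
assert (hp0 : Q <> 0) by now apply sqr_neq0.
assert (neg : forall x, x <> 0 -> - x <> 0).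
{ intros x hx h. apply hx. replace x with (- - x) by ring. rewrite h; ring. }
assert (hy : - (a * z * q) <> 0) by (apply neg; repeat apply Cmul_neq0; auto).
set (y := - (a * z * q)) in hy. set (c := Cinv a). set (d := b / y).
(* [A = 1/d] and [B = c y], while [a = 1/c] and [b = d y]: exchanging c and d turns the pair (a, b)
   into (A, B). *)
set (A := - (a * z * q / b)). set (B := - (z * q)).
assert (hc : c <> 0) by now apply Cinv_neq0.
assert (hd : d <> 0) by (apply Cmul_neq0; auto; now apply Cinv_neq0).
assert (hA : A <> 0) by (apply neg; apply Cmul_neq0; [repeat apply Cmul_neq0|apply Cinv_neq0]; auto).
assert (eA : A = y / b) by (unfold A, y; field; auto).
assert (hB : B <> 0) by (apply neg, Cmul_neq0; auto).
assert (eyw : forall r, CpowZ y r = CpowZ (- a) r * CpowZ z r * CpowZ q r).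
{ intros r. rewrite <- !CpowZ_mul_base by auto using Cmul_neq0. f_equal. unfold y; ring. }
assert (dyw : forall w, d * y * w = b * w) by (intros; unfold d; field; auto).
assert (cyw : forall w, c * y * w = B * w) by (intros; unfold c, y, B; field; auto).
assert (cpw : forall w, w <> 0 -> c * Q / w = Q / a / w) by (intros; unfold c; field; auto).
assert (dpw : forall w, w <> 0 -> d * Q / w = Q / A / w).
{ intros; unfold d; rewrite eA; field; auto. }
assert (hL : poch_neg_ok a Q -> poch_all_nz b Q ->
  qpinf b Q * qpinf (Q / a) Q * L = bisum (Fterm q y c d)).
{ intros ha' hb'. assert (hb'' := poch_all_nz_neg_ok q b hb').
  apply bisum_scaled; [apply Cmul_neq0; [now apply qpinf_neq0_all_nz|now apply qpinf_neq0_neg_ok]| |].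
  - now apply bicv_Fterm.
  - intros r. unfold Fterm, thetaW. fold Q. assert (hw := CpowZ_neq0 Q r hp0).
    rewrite dyw, cpw by auto.
    assert (h1 := qpinf_qpochZ q hq0 hq b r hb''). fold Q in h1. rewrite h1.
    assert (hr := qpochZ_qpinf_reflect q hq0 hq a r ha ha'). fold Q in hr.
    replace (1 * r)%Z with r by ring. rewrite eyw.
    replace (2 * (r * r) + -2 * r)%Z with (r * r - r + (r * r - r))%Z by ring.
    rewrite CpowZ_add by auto.
    assert (e : CpowZ q (r * r) = CpowZ q (r * r - r) * CpowZ q r)
      by (rewrite <- CpowZ_add by auto; f_equal; ring).
    rewrite e. set (Wq := CpowZ q (r * r - r)) in *.
    transitivity (qpochZ a Q r * qpinf (Q / a) Q * (qpinf (b * CpowZ Q r) Q * CpowZ z r * Wq * CpowZ q r));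
      [field; apply hb'|].
    rewrite hr. ring. }
split; [|split].
- intros ha' hb' hA' hB' nb na. specialize (hL ha' hb').
  assert (hB'' := poch_all_nz_neg_ok q B hB').
  set (S := bisum (fun r => qpochZ A Q r / qpochZ B Q r * CpowZ (- b) r * CpowZ q (r * r - r)%Z)).
  (* The reduction made for [L], now with (A, B) in place of (a, b); the splitting [y = (-A)(-b)]
     produces the power of [-b]. *)
  assert (hS : qpinf B Q * qpinf (Q / A) Q * S = bisum (Fterm q y d c)).
  { apply bisum_scaled; [apply Cmul_neq0; [now apply qpinf_neq0_all_nz|now apply qpinf_neq0_neg_ok]| |].
    - now apply bicv_Fterm.
    - intros r. unfold Fterm, thetaW. fold Q. assert (hw := CpowZ_neq0 Q r hp0).
      rewrite cyw, dpw by auto.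
      assert (h1 := qpinf_qpochZ q hq0 hq B r hB''). fold Q in h1. rewrite h1.
      assert (hr := qpochZ_qpinf_reflect q hq0 hq A r hA hA'). fold Q in hr.
      replace (1 * r)%Z with r by ring.
      replace y with (- A * - b) by (rewrite eA; field; auto).
      rewrite CpowZ_mul_base by auto.
      replace (2 * (r * r) + -2 * r)%Z with (r * r - r + (r * r - r))%Z by ring.
      rewrite CpowZ_add by auto. set (Wq := CpowZ q (r * r - r)) in *.
      transitivity (qpochZ A Q r * qpinf (Q / A) Q * (qpinf (B * CpowZ Q r) Q * CpowZ (- b) r * Wq));
        [field; apply hB'|].
      rewrite hr. ring. }
  replace (- (q * b / (a * z))) with (Q / A) by (unfold A, Q; field; auto).
  rewrite (bisum_F_sym q y hq0 hq hy c d hc hd), <- hS in hL.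
  apply Cmul_cancel_l with (qpinf b Q * qpinf (Q / a) Q); [now apply Cmul_neq0|].
  rewrite hL. field. auto.
- intros hba ha' hb' hA' nb. specialize (hL ha' hb').
  assert (na := qpinf_neq0_neg_ok q hq0 hq a ha ha'). fold Q in na.
  (* The assumption on |b/a| is exactly the convergence condition of G. *)
  assert (eba : y * c * d = b / a) by (unfold c, d; field; auto).
  set (S := bisum (fun r => qpochZ A Q r * qpochZ a Q r * CpowZ (b / a) r)).
  assert (hba' : (Cnorm (y * c * d) < 1)%R) by now rewrite eba.
  assert (nba : qpinf (b / a) Q <> 0).
  { apply qpinf_neq0; [now apply Cnorm_sqr_lt1|]. intros n h.
    assert (hn := Cnorm_mul_pow_le q hq (b / a) n). fold Q in hn. rewrite h, Cnorm1 in hn. lra. }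
  assert (hS : qpinf (b / a) Q * (qpinf (Q / A) Q * qpinf (Q / a) Q) * S = bisum (Gterm q y c d)).
  { apply bisum_scaled.
    - repeat apply Cmul_neq0; auto. now apply qpinf_neq0_neg_ok.
    - apply (bigeom_bicv (fun _ => Gterm q y c d) O).
      apply (bigeom_Gterm q y hq0 hq hy (fun _ => c) (fun _ => d) (Cnorm c) (Cnorm d));
        auto using Cnorm_gt0, Rle_refl.
      rewrite !Cnorm_mul in hba'. lra.
    - intros r. unfold Gterm, thetaW. fold Q. assert (hw := CpowZ_neq0 Q r hp0).
      rewrite cpw, dpw, eba by auto.
      assert (hr := qpochZ_qpinf_reflect q hq0 hq A r hA hA').
      assert (hr' := qpochZ_qpinf_reflect q hq0 hq a r ha ha'). fold Q in hr, hr'.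
      replace (1 * r)%Z with r by ring.
      replace y with (- A * (- a * (b / a))) by (rewrite eA; field; auto).
      assert (b / a <> 0) by (apply Cmul_neq0; auto).
      rewrite !CpowZ_mul_base by auto using Cmul_neq0.
      replace (2 * (r * r) + -2 * r)%Z with (r * r - r + (r * r - r))%Z by ring.
      rewrite CpowZ_add by auto.
      transitivity (qpinf (b / a) Q * ((qpochZ A Q r * qpinf (Q / A) Q)
        * (qpochZ a Q r * qpinf (Q / a) Q) * CpowZ (b / a) r)); [ring|].
      rewrite hr, hr'. ring. }
  replace (- (q * b / (a * z))) with (Q / A) by (unfold A, Q; field; auto).
  rewrite (bisum_F_G q y hq0 hq hy c d hc hd hba'), <- hS in hL.
  apply Cmul_cancel_l with (qpinf b Q * qpinf (Q / a) Q); [now apply Cmul_neq0|].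
  rewrite hL. field. auto.
- intros ha' hb' hA' hB' n1 n2 n3. specialize (hL ha' hb').
  assert (na := qpinf_neq0_neg_ok q hq0 hq a ha ha'). fold Q in na.
  assert (nb := qpinf_neq0_all_nz q hq b hb'). fold Q in nb.
  assert (hb'' := poch_all_nz_neg_ok q b hb').
  assert (hB'' := poch_all_nz_neg_ok q B hB').
  set (S := bisum (fun r => (one + a * z * CpowZ q (4 * r - 1)%Z)
           * qpochZ a Q r * qpochZ A Q r
           * CpowZ (b * a * z * z) r * CpowZ q (4 * r * r - 4 * r)%Z
           / ((one + a * z / q) * qpochZ b Q r * qpochZ B Q r))).
  assert (hS : (one + a * z / q) * (qpinf (Q / a) Q * qpinf (Q / A) Q * qpinf b Q * qpinf B Q) * S
    = bisum (Rterm q y c d)).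
  { apply bisum_scaled.
    - repeat apply Cmul_neq0; auto; first [now apply qpinf_neq0_all_nz|now apply qpinf_neq0_neg_ok].
    - now apply bicv_Rterm.
    - intros r. unfold Rterm, thetaV. fold Q. assert (hw := CpowZ_neq0 Q r hp0).
      rewrite cpw, dpw, dyw, cyw by auto.
      assert (h1 := qpinf_qpochZ q hq0 hq b r hb''). assert (h2 := qpinf_qpochZ q hq0 hq B r hB'').
      fold Q in h1, h2. rewrite h1, h2.
      assert (hr := qpochZ_qpinf_reflect q hq0 hq A r hA hA').
      assert (hr' := qpochZ_qpinf_reflect q hq0 hq a r ha ha'). fold Q in hr, hr'.
      assert (e1 : a * z * CpowZ q (4 * r - 1) = - (y * CpowZ Q r * CpowZ Q r / Q)).
      { replace (4 * r - 1)%Z with (r + r + (r + r) + -(1))%Z by ring.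
        rewrite (CpowZ_add q (r + r + (r + r))), (CpowZ_add q (r + r)), (CpowZ_add q r r),
          <- CpowZ_mul_base, CpowZ_opp, CpowZ_1 by auto.
        fold Q. unfold y, Q. field. auto. }
      (* Rests on [y^3 / q^2 = (-a)(-A)(b a z^2)]; the [q^(-2r)] comes from [6r^2 - 8r = -2r + 2(r^2
         - r) + (4r^2 - 4r)]. *)
      assert (e2 : CpowZ y (3 * r) * CpowZ q (6 * (r * r) + -8 * r)
        = CpowZ (- a) r * CpowZ (- A) r * CpowZ (b * a * z * z) r
          * (CpowZ q (r * r - r) * CpowZ q (r * r - r) * CpowZ q (4 * r * r - 4 * r))).
      { rewrite <- !CpowZ_add by auto. rewrite <- !CpowZ_mul_base by (repeat apply Cmul_neq0; auto).
        rewrite CpowZ_mul by auto.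
        replace (6 * (r * r) + -8 * r)%Z
          with (-(2) * r + (r * r - r + (r * r - r) + (4 * r * r - 4 * r)))%Z by ring.
        rewrite (CpowZ_add q (-(2) * r)), (CpowZ_mul q (-(2))) by auto.
        replace (CpowZ y 3) with (y * y * y) by (simpl; ring).
        replace (CpowZ q (-(2))) with (Cinv (q * q))
          by (rewrite CpowZ_opp by auto; simpl; field; auto).
        transitivity (CpowZ (y * y * y * Cinv (q * q)) r
          * CpowZ q (r * r - r + (r * r - r) + (4 * r * r - 4 * r))).
        - rewrite (CpowZ_mul_base (y * y * y)) by (try apply Cinv_neq0; repeat apply Cmul_neq0; auto).
          ring.
        - f_equal. f_equal. rewrite eA. unfold y. field. auto. }
      rewrite e2. change one with 1 in *. rewrite e1.
      transitivity ((1 + - (y * CpowZ Q r * CpowZ Q r / Q)) *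
        ((qpochZ A Q r * qpinf (Q / A) Q) * (qpochZ a Q r * qpinf (Q / a) Q)
        * qpinf (b * CpowZ Q r) Q * qpinf (B * CpowZ Q r) Q
        * CpowZ (b * a * z * z) r * CpowZ q (4 * r * r - 4 * r))).
      + clear h1 h2. assert (hbr := hb' r). assert (hBr := hB' r).
        generalize dependent (qpochZ b Q r). generalize dependent (qpochZ B Q r).
        generalize (1 + - (y * CpowZ Q r * CpowZ Q r / Q)). intros k v hv u hu.
        unfold one in n3.
        assert (n3' : q + a * z <> 0).
        { intros e. apply n3. replace (1 + a * z / q) with ((q + a * z) / q) by (field; auto).
          rewrite e; field; auto. }
        field. auto.
      + rewrite hr, hr'. ring. }
  assert (hR := bisum_F_R q y hq0 hq hy c d hc hd). rewrite <- hS, <- hL in hR. fold Q in hR.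
  replace (- (b * q / (a * z))) with (Q / A) by (unfold A, Q; field; auto).
  replace (- (q * z)) with B by (unfold B; ring).
  assert (ey : - (a * q * z) = y) by (unfold y; ring).
  assert (epy : - (q * q * q / (a * z)) = Q * Q / y) by (unfold y, Q; field; auto).
  rewrite ey in *. rewrite epy in *.
  (* The factor of F contains [P(p/y)], the claim [P(p^2/y)]. The factor split off, times [-(y/p)],
     is [1 + az/q], the constant in the denominator of the summand. *)
  assert (h1 := qpinf_step q hq (Q / y) (Q * Q / y) ltac:(unfold Q; field; auto)).
  fold Q in h1. rewrite h1 in hR.
  apply Cmul_cancel_l with
    ((one + a * z / q) * (qpinf y Q * qpinf (Q * Q / y) Q) * (qpinf b Q * qpinf (Q / a) Q)).
  { repeat apply Cmul_neq0; auto. }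
  transitivity (- (y / Q) * (qpinf y Q * ((1 - Q / y) * qpinf (Q * Q / y) Q))
    * (qpinf b Q * qpinf (Q / a) Q * L)).
  + replace (one + a * z / q) with (- (y / Q) * (1 - Q / y)); [ring|].
    unfold one, y, Q. field. auto.
  + rewrite hR. field. auto.
Qed.
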